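(* Let $V\in\mathbb{V}_2^{\mathrm o}(\mathbb{R}^3)$ be an oriented $2$-varifold with locally bounded first variation and singular part $\beta_V$, and let $\eta\in L^\infty(\beta_V;\mathbb{S}^2)$ and $H\in L^1_{\mathrm{loc}}(\mu_V;\mathbb{R}^3)$ satisfy $$\delta V(X)=-\int_{\mathbb{R}^3}\langle X,H\rangle\,d\mu_V+\int_{\mathbb{R}^3}\langle X,\eta\rangle\,d\beta_V\quad\text{for all }X\in C^1_c(\mathbb{R}^3;\mathbb{R}^3)$$ and $H(x)\wedge\star\xi=0$ for $V$-almost all $(x,\xi)$. Let $c_0\in\mathbb{R}$ and suppose that $\mathcal{H}_{c_0}(V)<\infty$ and $$\theta^{*2}(\mu_V,\infty):=\limsup_{\rho\to\infty}\frac{\mu_V(B_\rho(0))}{\pi\rho^2}<\infty.$$ Then for all $x_0\in\mathbb{R}^3\setminus\operatorname{spt}\beta_V$ we have $$\begin{aligned}\theta^2(\mu_V,x_0)\le{}&\theta^{*2}(\mu_V,\infty)+\frac1{4\pi}\mathcal{H}_{c_0}(V)\\&+\limsup_{\rho\to\infty}\frac{c_0}{2\pi}\left(\int_{B_\rho(x_0)\times\mathbb{G}^{\mathrm o}(3,2)}\left(\rho^{-2}-|x-x_0|^{-2}\right)\langle x-x_0,\star\xi\rangle\,dV(x,\xi)\right)\\&+\limsup_{\rho\to\infty}\frac1{2\pi}\left(\int_{B_\rho(x_0)}\left(|x-x_0|^{-2}-\rho^{-2}\right)\langle x-x_0,\eta(x)\rangle\,d\beta_V(x)\right).\end{aligne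d}$$
   Context: $\mathbb{G}^{\mathrm o}(3,2)=\{\xi\in\bigwedge_2\mathbb{R}^3:\ \xi\text{ simple},\ |\xi|=1\}$ is the set of oriented 2-dimensional subspaces of $\mathbb{R}^3$. For $\xi\in\mathbb{G}^{\mathrm o}(3,2)$, $T(\xi)=\{v\in\mathbb{R}^3: v\wedge\xi=0\}$ is the underlying unoriented plane, and $\star\xi\in\mathbb{S}^2$ is its Hodge dual ($\star(v_1\wedge v_2)=v_1\times v_2$). An oriented $2$-varifold on $\mathbb{R}^3$ is a Radon measure $V$ on $\mathbb{G}_2^{\mathrm o}(\mathbb{R}^3)=\mathbb{R}^3\times\mathbb{G}^{\mathrm o}(3,2)$; the set of these is $\mathbb{V}_2^{\mathrm o}(\mathbb{R}^3)$. The weight measure $\mu_V$ is the push forward of $V$ to $\mathbb{R}^3$ under the projection. The first variation is $\delta V(X)=\int\operatorname{div}_{T(\xi)}X(x)\,dV(x,\xi)$ for $X\in C_c^1(\mathbb{R}^3;\mathbb{R}^3)$, where $\operatorname{div}_TX=\sum_{j=1}^2\langle e_j,DX\,e_j\rangle$ for an orthonormal basis $e_1,e_2$ of $T$. $V$ has locally bounded first variation if the total variation $\|\delta V\|$ is a Radon measure; then $\beta_V$ denotes the singular part of $\|\delta V\|$ with respect to $\mu_V$ (Lebesgue decomposition). The Helfrich energy is $\mathcal{H}_{c_0}(V)=\frac14\int|H(x)-c_0(\star\xi)|^2\,dV(x,\xi)$. $B_\rho(x)$ is the closed ball, $\theta^2(\mu_V,x)=\lim_{\rho\to0+}\mu_V(B_\rho(x))/(\pi\rho^2)$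 is the density (existence of the limit is part of the assertion), and $\operatorname{spt}$ denotes the support of a measure.
   Formalization: The inequality is asserted only when the sum of the two limsups on the right is defined, i.e. not when one is +∞ and the other −∞ (which can happen, leaving the right-hand side meaningless); existence of the density is asserted in every case. *)

(* Defs.v *)
From HB Require Import structures.
From mathcomp Require Import all_boot all_order all_algebra.
From mathcomp Require Import all_classical all_reals all_analysis.

Set Implicit Arguments.
Unset Strict Implicit.
Unset Printing Implicit Defensive.

Import Order.TTheory GRing.Theory Num.Theory.
Import numFieldNormedType.Exports.

Local Open Scope classical_set_scope.
Local Open Scope ring_scope.

(* The library norm on matrices is the sup norm; it induces the Euclidean
   topology, but balls and lengths below use the Euclidean norm. *)
Definition dot (R : realType) (u v : 'rV[R]_3) : R :=
  \sum_(i < 3) u 0 i * v 0 i.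

Definition enorm (R : realType) (v : 'rV[R]_3) : R := Num.sqrt (dot v v).

Definition eball (R : realType) (x : 'rV[R]_3) (r : R) : set 'rV[R]_3 :=
  [set y | enorm (y - x) <= r].

Definition cross (R : realType) (v w : 'rV[R]_3) : 'rV[R]_3 :=
  \row_k (v 0 (k + 1) * w 0 (k + 2) - v 0 (k + 2) * w 0 (k + 1)).

(* A k-vector of R^3 is represented by its alternating array of coordinates:
   the entry of index (i1, ..., ik) is the coefficient on
   e_i1 /\ ... /\ e_ik, so that 2-vectors are skew-symmetric matrices. *)
Definition wedge (R : realType) (v w : 'rV[R]_3) : 'M[R]_3 :=
  \matrix_(i, j) (v 0 i * w 0 j - v 0 j * w 0 i).

Definition wedge12 (R : realType) (v : 'rV[R]_3) (xi : 'M[R]_3)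
    (i j k : 'I_3) : R :=
  v 0 i * xi j k + v 0 j * xi k i + v 0 k * xi i j.

Definition simple2 (R : realType) (xi : 'M[R]_3) : Prop :=
  exists v w, xi = wedge v w.

(* Norm for which the e_i /\ e_j with i < j are orthonormal. *)
Definition norm2 (R : realType) (xi : 'M[R]_3) : R :=
  Num.sqrt (\sum_(i < 3) \sum_(j < 3 | (i < j)%N) xi i j ^+ 2).

Definition star (R : realType) (xi : 'M[R]_3) : 'rV[R]_3 :=
  \row_k xi (k + 1) (k + 2).

Lemma star_wedge (R : realType) (v w : 'rV[R]_3) :
  star (wedge v w) = cross v w.
Proof. by apply/rowP => k; rewrite !mxE. Qed.

Definition plane (R : realType) (xi : 'M[R]_3) : set 'rV[R]_3 :=
  [set v | forall i j k, wedge12 v xi i j k = 0].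

Definition Go_set (R : realType) : set 'M[R]_3 :=
  [set xi | simple2 xi /\ norm2 xi = 1].

#[short(type="topMeasurableType")]
HB.structure Definition TopMeasurable d :=
  {T of Topological T & Measurable d T}.

(* On the second countable spaces used here the product sigma-algebra is the
   Borel sigma-algebra of the product topology. *)
HB.instance Definition _ d1 d2 (T1 : topMeasurableType d1)
    (T2 : topMeasurableType d2) := Measurable.on (T1 * T2)%type.

HB.instance Definition _ (R : realType) (m n : nat) :=
  @isMeasurable.Build (sigma_display (@open 'M[R]_(m, n))) 'M[R]_(m, n)
    <<s @open 'M[R]_(m, n) >> (@sigma_algebra0 _ setT _)
    (@sigma_algebraC _ _) (@sigma_algebra_bigcup _ setT _).

(* set_type carries the subspace topology. *)
Definition Go (R : realType) : Type := set_type (@Go_set R).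

Definition Go_val (R : realType) (xi : Go R) : 'M[R]_3 := set_val xi.

HB.instance Definition _ (R : realType) := Topological.on (Go R).

Lemma Go_set_e01 (R : realType) :
  wedge (delta_mx 0 0) (delta_mx 0 1) \in @Go_set R.
Proof.
rewrite inE; split; first by exists (delta_mx 0 0), (delta_mx 0 1).
rewrite /norm2 -[RHS]sqrtr1; congr Num.sqrt.
do 4! rewrite ?big_mkcond ?big_ord_recl ?big_ord0 /=; rewrite !mxE /=.
by rewrite !(mulr0, mul0r, mulr1, subr0, oppr0, expr2, addr0, add0r).
Qed.

HB.instance Definition _ (R : realType) :=
  isPointed.Build (Go R)
    (exist (fun xi => xi \in @Go_set R) _ (Go_set_e01 R)).

HB.instance Definition _ (R : realType) :=
  @isMeasurable.Build (sigma_display (@open (Go R))) (Go R)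
    <<s @open (Go R) >> (@sigma_algebra0 _ setT _)
    (@sigma_algebraC _ _) (@sigma_algebra_bigcup _ setT _).

Definition radon d (T : topMeasurableType d) (R : realType)
    (mu : {measure set T -> \bar R}) : Prop :=
  [/\ forall K, compact K -> (mu K < +oo)%E,
     forall A, measurable A ->
       mu A = ereal_inf [set mu U | U in [set U | open U /\ A `<=` U]]
   & forall U, open U ->
       mu U = ereal_sup [set mu K | K in [set K | compact K /\ K `<=` U]]].

Definition spt d (T : topMeasurableType d) (R : realType)
    (mu : {measure set T -> \bar R}) : set T :=
  ~` \bigcup_(U in [set U | open U /\ mu U = 0%E]) U.

Definition mutually_singular d (T : measurableType d) (R : realType)
    (mu nu : set T -> \bar R) : Prop :=
  exists A, [/\ measurable A, mu A = 0%E & nu (~` A) = 0%E].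

(* Set functions are compared on measurable sets only, as the values of a
   library measure on other sets are unspecified. *)
Definition singular_part d (T : measurableType d) (R : realType)
    (nu mu : set T -> \bar R) (nus : {measure set T -> \bar R}) : Prop :=
  exists nua : {measure set T -> \bar R},
    [/\ forall A, measurable A -> nu A = (nua A + nus A)%E,
       nua `<< mu & mutually_singular nus mu].

Section varifold.
Variable R : realType.
Implicit Types (V : {measure set ('rV[R]_3 * Go R) -> \bar R})
  (X : 'rV[R]_3 -> 'rV[R]_3).

Definition weight_measure V : set 'rV[R]_3 -> \bar R := pushforward V fst.

Let weight0 V : weight_measure V set0 = 0%E.
Proof. by rewrite /weight_measure /pushforward preimage_set0 measure0. Qed.

Let weight_ge0 V A : (0 <= weight_measure V A)%E.
Proof. exact: measure_ge0. Qed.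

Let weight_semi_sigma_additive V : semi_sigma_additive (weight_measure V).
Proof.
move=> F mF tF mUF; rewrite /weight_measure /pushforward preimage_bigcup.
have mfst B : measurable B -> measurable (@fst 'rV[R]_3 (Go R) @^-1` B).
  by move=> mB; rewrite -[X in measurable X]setTI; exact: measurable_fst.
apply: measure_semi_sigma_additive; first by move=> n; exact: mfst.
- apply/trivIsetP => i j _ _ ij; rewrite -preimage_setI.
  by move/trivIsetP : tF => /(_ _ _ _ _ ij) ->//; rewrite preimage_set0.
- by rewrite -preimage_bigcup; exact: mfst.
Qed.

HB.instance Definition _ V := isMeasure.Build _ _ _ (weight_measure V)
  (weight0 V) (@weight_ge0 V) (@weight_semi_sigma_additive V).

Definition orthonormal_basis (T : set 'rV[R]_3)
    (e : 'rV[R]_3 * 'rV[R]_3) : Prop :=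
  [/\ dot e.1 e.1 = 1, dot e.2 e.2 = 1, dot e.1 e.2 = 0
   & T = [set a.1 *: e.1 + a.2 *: e.2 | a in [set: R * R]]].

(* The value does not depend on the orthonormal basis chosen by xget. *)
Definition tangential_div (T : set 'rV[R]_3) X (x : 'rV[R]_3) : R :=
  let e := xget 0 (orthonormal_basis T) in
  dot e.1 ('d X x e.1) + dot e.2 ('d X x e.2).

Definition C1c X : Prop :=
  [/\ forall x, differentiable X x, continuous (jacobian X)
   & compact (closure [set x | X x != 0])].

Definition first_variation V X : R :=
  \int[V]_z tangential_div (plane (Go_val z.2)) X z.1.

Definition first_variation_norm_open V (U : set 'rV[R]_3) : \bar R :=
  ereal_sup [set (first_variation V X)%:E | X in
    [set X | [/\ C1c X, closure [set x | X x != 0] `<=` U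
                & forall x, enorm (X x) <= 1]]].

Definition first_variation_norm V (A : set 'rV[R]_3) : \bar R :=
  ereal_inf [set first_variation_norm_open V U | U in
    [set U | open U /\ A `<=` U]].

Definition locally_bounded_first_variation V : Prop :=
  exists2 nu : {measure set 'rV[R]_3 -> \bar R}, radon nu &
    forall A, measurable A -> nu A = first_variation_norm V A.

Definition helfrich V (c0 : R) (H : 'rV[R]_3 -> 'rV[R]_3) : \bar R :=
  ((4^-1)%:E * \int[V]_z (enorm (H z.1 - c0 *: star (Go_val z.2)) ^+ 2)%:E)%E.

Definition L1loc (mu : {measure set 'rV[R]_3 -> \bar R})
    (H : 'rV[R]_3 -> 'rV[R]_3) : Prop :=
  measurable_fun setT H /\
  forall K, compact K -> mu.-integrable K (fun x => (enorm (H x))%:E).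

(* L^infty(mu; S^2): essential boundedness is automatic. *)
Definition Linfty_sphere (mu : {measure set 'rV[R]_3 -> \bar R})
    (eta : 'rV[R]_3 -> 'rV[R]_3) : Prop :=
  measurable_fun setT eta /\ {ae mu, forall x, enorm (eta x) = 1}.

Definition density_ratio (mu : set 'rV[R]_3 -> \bar R) (x : 'rV[R]_3)
    (rho : R) : \bar R :=
  (mu (eball x rho) * ((pi * rho ^+ 2)^-1)%:E)%E.

Definition upper_density_oo (mu : set 'rV[R]_3 -> \bar R) : \bar R :=
  limf_esup (density_ratio mu 0) +oo.

(* The limit is required to be finite. *)
Definition is_density (mu : set 'rV[R]_3 -> \bar R) (x : 'rV[R]_3)
    (theta : R) : Prop :=
  density_ratio mu x rho @[rho --> 0^'+] --> theta%:E.

End varifold.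

(* Main.v *)
(* Test the first variation with the field X = (1/max(|y|^2, a) - 1/max(|y|^2, b)) y,
   where y = x - x0 and a = sigma^2 < b = rho^2; it is a limit of C^1 radial
   fields.  With N = <y, *xi> and h = <H, *xi>, perpendicularity of H turns
   <y, H> into N h, and on the annulus sigma < |y| <= rho the integrand is
   -2/b + 2 N^2/|y|^4 + (1/|y|^2 - 1/b) N h.

   Near x0, where beta vanishes, completing the square in N/|y|^2 shows that
   2 sigma^-2 mu(B_sigma) + sigma^-2 int_(B_sigma) <y, H> + 1/8 int_(B_sigma) h^2
   is nondecreasing in sigma.  Hence the density ratios are bounded, x0 is not
   charged, the last two terms tend to 0 and the density exists; the discarded
   square also shows that N/|y|^2 is locally square integrable.

   For the inequality put h = c0 + g and complete the square with g instead of
   h: this costs 1/8 int g^2 <= H_(c0)(V)/2 and leaves the c0-term of the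
   statement.  Let sigma -> 0, then rho -> oo: the remaining error
   rho^-2 int_(B_rho) |N g| vanishes by Young's inequality, because g is in L^2
   and mu(B_rho) = O(rho^2). *)

Require Import Defs.
From HB Require Import structures.
From mathcomp Require Import all_boot all_order all_algebra.
From mathcomp Require Import all_classical all_reals all_analysis.
From mathcomp Require Import measurable_realfun ring lra.

Set Implicit Arguments.
Unset Strict Implicit.
Unset Printing Implicit Defensive.

Import Order.TTheory GRing.Theory Num.Theory.
Import numFieldNormedType.Exports.

Local Open Scope classical_set_scope.
Local Open Scope ring_scope.

(** The square has to be completed twice because of an obstacle at [x0]. The first variation
    identity gives the integral of [mono_integrand a b] only as a whole, and its integrability only
    through bounds that blow up like [1/a]. Nothing is known beforehand about [u = N/|y|^2] near
    [x0], so the [c0]-integral of the statement could fail to converge there. The pass with [h]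
    yields constants that depend on the unknown local energy of [h], too weak for the inequality,
    but it proves that [x0] is not charged and that [u] is locally square integrable. Only then does
    the pass with [g] make sense: its [c0]-term is linear in [u], has no sign, and is kept as an
    integral instead of being absorbed in a square.

    The density is [L / pi], where [L] is the limit of [mu(B_sigma) / sigma^2]. The final inequality
    bounds [2 L], and division by [2 pi] turns [1/8 int g^2] into [1/(16 pi) int g^2]; the last
    factor [1/4] is the one in the Helfrich energy. *)

(** * Measurability and integration of real functions *)

Section real_integrals.
Context d (T : measurableType d) (R : realType).
Variable mu : {measure set T -> \bar R}.
Implicit Types (f g : T -> R).

Lemma measurable_funV f : measurable_fun setT f ->
  measurable_fun setT (fun x => (f x)^-1).
Proof.
suff mV : measurable_fun setT (fun x : R => x^-1).
  by move=> mf; exact: (measurableT_comp mV mf).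
(* Inversion is discontinuous at 0, where its value is 0 by convention; elsewhere it is continuous
   on an open set. *)
have -> : (fun x : R => x^-1) = (fun x => if x != 0 then x^-1 else 0).
  by apply/funext => x; case: eqP => //= ->; rewrite invr0.
have m0 : measurable [set x : R | x != 0] by apply: open_measurable; exact: open_neq.
apply: measurable_fun_if => //.
- by apply: measurable_neg; apply: measurable_fun_eqr.
- rewrite setTI (_ : _ @^-1` _ = [set x : R | x != 0])//.
  apply: subspace_continuous_measurable_fun => //.
  apply: continuous_in_subspaceT => x /set_mem /= x0.
  exact: inv_continuous.
Qed.

Lemma rintegrable_measurable f : mu.-integrable setT (EFin \o f) ->
  measurable_fun setT f.
Proof. by case/integrableP => /measurable_EFinP. Qed.

Lemma rintegrable_le g f : measurable_fun setT f ->
  mu.-integrable setT (EFin \o g) ->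
  (forall x, `|f x| <= g x) -> mu.-integrable setT (EFin \o f).
Proof.
move=> mf ig fg; apply: le_integrable ig => //; first exact/measurable_EFinP.
by move=> x _ /=; rewrite lee_fin (le_trans (fg x))// ler_norm.
Qed.

Lemma rintegrableD f g : mu.-integrable setT (EFin \o f) ->
  mu.-integrable setT (EFin \o g) ->
  mu.-integrable setT (EFin \o (fun x => f x + g x)).
Proof.
move=> fi gi; rewrite (_ : _ \o _ = (EFin \o f) \+ (EFin \o g))%E//.
exact: integrableD.
Qed.

Lemma rintegrableZl k f : mu.-integrable setT (EFin \o f) ->
  mu.-integrable setT (EFin \o (fun x => k * f x)).
Proof.
by move=> fi; have := integrableZl measurableT k fi; apply: eq_integrable.
Qed.

Lemma rintegrable_norm f : mu.-integrable setT (EFin \o f) ->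
  mu.-integrable setT (EFin \o (fun x => `|f x|)).
Proof.
move=> fi; have := integrable_norm fi; exact: eq_integrable.
Qed.

Lemma Rintegral_ae_eq f g : measurable_fun setT f -> measurable_fun setT g ->
  {ae mu, forall x, f x = g x} -> \int[mu]_x f x = \int[mu]_x g x.
Proof.
move=> mf mg fg; congr fine; apply: ae_eq_integral => //.
- exact/measurable_EFinP.
- exact/measurable_EFinP.
- by apply: filterS fg => x /= -> _.
Qed.

Lemma cvg_Rintegral_dominated (f_ : nat -> T -> R) f g :
  (forall n, measurable_fun setT (f_ n)) -> measurable_fun setT f ->
  {ae mu, forall x, f_ n x @[n --> \oo] --> f x} ->
  mu.-integrable setT (EFin \o g) ->
  {ae mu, forall x n, `|f_ n x| <= g x} ->
  mu.-integrable setT (EFin \o f) /\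
  \int[mu]_x f_ n x @[n --> \oo] --> \int[mu]_x f x.
Proof.
move=> mf_ mf f_f ig f_g.
have [] := @dominated_convergence _ _ _ mu setT measurableT
  (fun n => EFin \o f_ n) (EFin \o f) (EFin \o g).
- by move=> n; exact/measurable_EFinP.
- exact/measurable_EFinP.
- apply: filterS f_f => x f_f _; apply: cvg_EFin; last exact: f_f.
  by apply: nearW.
- by [].
- by apply: filterS f_g => x + n _ => /(_ n); rewrite lee_fin.
move=> fi _ If; split=> //.
apply: (@fine_cvg _ _ _ _ (fun n => \int[mu]_x (f_ n x)%:E)%E).
rewrite fineK; first exact: If.
exact: (integrable_fin_num measurableT fi).
Qed.

End real_integrals.

(** Bundling integrability with the value lets long linear combinations of integrals be built as
    terms, after which [has_integral_le] leaves only a pointwise inequality. *)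
Definition has_integral d (T : measurableType d) (R : realType)
    (mu : {measure set T -> \bar R}) (f : T -> R) (r : R) : Prop :=
  mu.-integrable setT (EFin \o f) /\ \int[mu]_x f x = r.

Section has_integral_theory.
Context d (T : measurableType d) (R : realType).
Variable mu : {measure set T -> \bar R}.
Implicit Types (f g : T -> R) (r k : R).

Lemma has_integralI f : mu.-integrable setT (EFin \o f) ->
  has_integral mu f (\int[mu]_x f x).
Proof. by []. Qed.

Lemma has_integralD f g r k : has_integral mu f r -> has_integral mu g k ->
  has_integral mu (fun x => f x + g x) (r + k).
Proof.
move=> [fi <-] [gi <-]; split; first exact: rintegrableD.
by rewrite RintegralD.
Qed.

Lemma has_integralZ f r k : has_integral mu f r ->
  has_integral mu (fun x => k * f x) (k * r).
Proof.
by move=> [fi <-]; split; [exact: rintegrableZl|rewrite RintegralZl].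
Qed.

Lemma has_integral_le f g r k : has_integral mu f r -> has_integral mu g k ->
  (forall x, f x <= g x) -> r <= k.
Proof. by move=> [fi <-] [gi <-] fg; apply: le_Rintegral. Qed.

End has_integral_theory.

(** * The monotonicity inequalities on an abstract measure space *)

(* The geometry enters only through [s = |x - x0|^2], [N = <x - x0, *xi>] and
   [h = <H, *xi>]; radii are squared throughout ([a = sigma^2], [b = rho^2]).
   [B0 b] stands for the boundary term at radius [b], which vanishes on the
   small balls that [beta] does not charge. *)
Section monotonicity.
Context d (T : measurableType d) (R : realType).
Variable mu : {measure set T -> \bar R}.
Variables (s N h : T -> R) (c0 a0 : R) (B0 : R -> R).
Hypotheses (ms : measurable_fun setT s) (mN : measurable_fun setT N)
  (mh : measurable_fun setT h).
Hypotheses (s_ge0 : forall z, 0 <= s z) (N_le_s : forall z, N z ^+ 2 <= s z).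
Hypothesis fin_ball : forall b, (mu [set z | (s z <= b)%R] < +oo)%E.

Let g z := h z - c0.

Hypothesis g2_int : mu.-integrable setT (EFin \o (fun z => g z ^+ 2)).

(* Tangential divergence plus curvature term of the radial field
   [(1 / max s a - 1 / max s b) (x - x0)]. *)
Definition mono_integrand (a b : R) z :=
  if s z <= a then (a^-1 - b^-1) * (2 + N z * h z)
  else if s z <= b then
    - 2 * b^-1 + 2 * (N z / s z) ^+ 2 + ((s z)^-1 - b^-1) * (N z * h z)
  else 0.

Hypothesis a0_gt0 : 0 < a0.
(** The right-hand side does not depend on [a]: for [a <= a0] the inner truncation takes place in a
    ball that [beta] does not charge. *)
Hypothesis int_mono : forall a b : R, 0 < a -> a <= a0 -> a < b ->
  \int[mu]_z mono_integrand a b z = B0 b.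
Hypothesis B0_eq0 : forall b, b <= a0 -> B0 b = 0.

(** An explicit conditional, so that pointwise inequalities split by cases on [s z] into goals for
    [lra]. *)
Definition sublevel (b : R) z : R := if s z <= b then 1 else 0.
Local Notation ind := sublevel.

Lemma sublevelE (b : R) : ind b = \1_[set z | s z <= b].
Proof.
apply/funext => z; rewrite /sublevel indicE.
by case: ifPn => sb; [rewrite mem_set|rewrite memNset//=; exact/negP].
Qed.

Lemma measurable_sublevel_set (b : R) : measurable [set z | s z <= b].
Proof.
rewrite -[X in measurable X]setTI.
rewrite (_ : mkset _ = s @^-1` `]-oo, b]%classic); first exact: ms.
by apply/seteqP; split => z; rewrite /= in_itv.
Qed.

Lemma measurable_sublevel (b : R) : measurable_fun setT (ind b).
Proof.
by rewrite sublevelE; exact/measurable_indicP/measurable_sublevel_set.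
Qed.

Lemma integral_sublevel (b : R) :
  (\int[mu]_z (ind b z)%:E = mu [set z | (s z <= b)%R])%E.
Proof.
rewrite sublevelE integral_indic ?setIT//; exact: measurable_sublevel_set.
Qed.

Let mNh : measurable_fun setT (fun z => N z * h z).
Proof. exact: measurable_funM. Qed.

Let mg : measurable_fun setT g.
Proof. exact: measurable_funB. Qed.

Let mNs : measurable_fun setT (fun z => N z / s z).
Proof. by apply: measurable_funM => //; exact: measurable_funV. Qed.

Lemma integrable_sublevel (b : R) : mu.-integrable setT (EFin \o ind b).
Proof.
apply/integrableP; split; first exact/measurable_EFinP/measurable_sublevel.
rewrite (eq_integral (fun z => (ind b z)%:E)) ?integral_sublevel// => z _ /=.
by rewrite ger0_norm// /sublevel; case: ifP.
Qed.

Let i_ind := integrable_sublevel.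

(** On a ball [1 + h^2] is integrable, since [h = g + c0] gives [h^2 <= 2 g^2 + 2 c0^2]; the
    integrability of the products below is read off from it. *)
Let i_G (k b : R) (F : T -> R) : 0 <= k -> measurable_fun setT F ->
  (forall z, s z <= b -> `|F z| <= k * (1 + h z ^+ 2)) ->
  mu.-integrable setT (EFin \o (fun z => ind b z * F z)).
Proof.
move=> k0 mF Fb.
have i2 : mu.-integrable setT (EFin \o (fun z =>
    k * (2 * g z ^+ 2 + (2 * c0 ^+ 2 + 1) * ind b z))).
  by apply: rintegrableZl; apply: rintegrableD; apply: rintegrableZl.
apply: rintegrable_le i2 _.
  by apply: measurable_funM => //; exact: measurable_sublevel.
move=> z; rewrite /sublevel; case: ifPn => sb; last first.
  by rewrite mul0r mulr0 addr0 normr0 mulr_ge0// mulr_ge0// sqr_ge0.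
rewrite mul1r mulr1 (le_trans (Fb _ sb))// ler_wpM2l//.
have := sqr_ge0 (g z - c0); rewrite /g; lra.
Qed.

Let Nh_le z : `|N z * h z| <= (s z + h z ^+ 2) / 2.
Proof.
have := N_le_s z; have := sqr_ge0 (N z - h z); have := sqr_ge0 (N z + h z).
by rewrite ler_norml => *; apply/andP; split; lra.
Qed.

Let Ng_le z : `|N z * g z| <= (s z + g z ^+ 2) / 2.
Proof.
have := N_le_s z; have := sqr_ge0 (N z - g z); have := sqr_ge0 (N z + g z).
by rewrite ler_norml => *; apply/andP; split; lra.
Qed.

Let i_Nh (b : R) : mu.-integrable setT (EFin \o (fun z => ind b z * `|N z * h z|)).
Proof.
apply: (@i_G (`|b| + 1)) => //; first exact: measurableT_comp.
move=> z sb; rewrite normr_id (le_trans (Nh_le z))//.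
have := sqr_ge0 (h z); have := s_ge0 z; have := ler_norm b; nra.
Qed.

Let i_h2 (b : R) : mu.-integrable setT (EFin \o (fun z => ind b z * h z ^+ 2)).
Proof.
apply: (@i_G 1) => //; first exact: measurable_funX.
by move=> z sb; rewrite ger0_norm ?sqr_ge0//; lra.
Qed.

Let i_Ng (b : R) : mu.-integrable setT (EFin \o (fun z => ind b z * `|N z * g z|)).
Proof.
apply: (@i_G (`|b| + c0 ^+ 2 + 1)).
- by rewrite !addr_ge0 ?sqr_ge0.
- by apply: measurableT_comp => //; exact: measurable_funM.
move=> z sb; rewrite normr_id (le_trans (Ng_le z))//.
have := sqr_ge0 (h z); have := s_ge0 z; have := ler_norm b.
have := sqr_ge0 (h z + c0); have := sqr_ge0 (c0 * h z); rewrite /g; nra.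
Qed.

Let i_N (b : R) : mu.-integrable setT (EFin \o (fun z => ind b z * N z)).
Proof.
apply: (@i_G (`|b| + 1)) => //.
move=> z sb.
have : `|N z| <= (1 + s z) / 2.
  have := N_le_s z; have := sqr_ge0 (N z - 1); have := sqr_ge0 (N z + 1).
  by rewrite ler_norml => *; apply/andP; split; lra.
move=> /le_trans; apply.
have := sqr_ge0 (h z); have := s_ge0 z; have := ler_norm b; nra.
Qed.

Lemma measurable_mono_integrand (a b : R) :
  measurable_fun setT (mono_integrand a b).
Proof.
apply: measurable_fun_ifT; first exact: measurable_fun_ler.
  by apply: measurable_funM => //; apply: measurable_funD.
apply: measurable_fun_ifT => //; first exact: measurable_fun_ler.
apply: measurable_funD.
  apply: measurable_funD => //; apply: measurable_funM => //.
  exact: measurable_funX.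
apply: measurable_funM => //; apply: measurable_funB => //.
exact: measurable_funV.
Qed.

(** Outside the inner ball [(N/s)^2 <= 1/s < 1/a], so a multiple of [1 + |N h|] dominates on the
    ball of squared radius [b]. The bound degenerates as [a] tends to 0. *)
Let i_mono (a b : R) : 0 < a -> a < b ->
  mu.-integrable setT (EFin \o mono_integrand a b).
Proof.
move=> a0' ab; have b0 := lt_trans a0' ab.
have i4 : mu.-integrable setT (EFin \o (fun z =>
    4 * a^-1 * (ind b z + ind b z * `|N z * h z|))).
  by apply: rintegrableZl; apply: rintegrableD.
apply: rintegrable_le i4 _ => [|z]; first exact: measurable_mono_integrand.
rewrite /sublevel /mono_integrand.
have ia : 0 < a^-1 by rewrite invr_gt0.
have ib : 0 < b^-1 by rewrite invr_gt0.
have iab : b^-1 < a^-1 by rewrite ltf_pV2.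
have Pn := normr_ge0 (N z * h z).
have Pl : `|N z * h z| <= `|N z * h z| by [].
move: Pl; rewrite {1}ler_norml => /andP[P1 P2].
case: ifPn => sa.
  have -> : s z <= b by rewrite (le_trans sa)// ltW.
  rewrite mul1r ler_norml; apply/andP; split; nra.
case: ifPn => sb; last by rewrite mul0r addr0 mulr0 normr0.
rewrite -ltNge in sa.
have s0 := lt_trans a0' sa.
have is0 : 0 < (s z)^-1 by rewrite invr_gt0.
have isa : (s z)^-1 < a^-1 by rewrite ltf_pV2.
have isb : b^-1 <= (s z)^-1 by rewrite lef_pV2.
have Ns : (N z / s z) ^+ 2 <= (s z)^-1.
  rewrite exprMn exprVn ler_pdivrMr ?exprn_gt0//.
  by rewrite (expr2 (s z)) mulKf ?gt_eqF.
have := sqr_ge0 (N z / s z).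
rewrite mul1r ler_norml => *; apply/andP; split; nra.
Qed.

Let i_Nh' b : mu.-integrable setT (EFin \o (fun z => ind b z * (N z * h z))).
Proof.
apply: rintegrable_le (i_Nh b) _.
  by apply: measurable_funM => //; exact: measurable_sublevel.
by move=> z; rewrite normrM /sublevel; case: ifP; rewrite (normr1, normr0).
Qed.

(** * The monotone quantity and the existence of the density *)

Let M (a : R) := \int[mu]_z ind a z.
Let IN (a : R) := \int[mu]_z (ind a z * (N z * h z)).
Let IaN (a : R) := \int[mu]_z (ind a z * `|N z * h z|).
Let Ih (a : R) := \int[mu]_z (ind a z * h z ^+ 2).

Let hM (a : R) : has_integral mu (ind a) (M a). Proof. exact: has_integralI. Qed.
Let hN (a : R) : has_integral mu (fun z => ind a z * (N z * h z)) (IN a).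
Proof. exact: has_integralI. Qed.
Let haN (a : R) : has_integral mu (fun z => ind a z * `|N z * h z|) (IaN a).
Proof. exact: has_integralI. Qed.
Let hh (a : R) : has_integral mu (fun z => ind a z * h z ^+ 2) (Ih a).
Proof. exact: has_integralI. Qed.

Let hPhi (a b : R) : 0 < a -> a <= a0 -> a < b ->
  has_integral mu (mono_integrand a b) (B0 b).
Proof. by move=> a1 a2 ab; split; [exact: i_mono|exact: int_mono]. Qed.

(** Integrand of the monotone quantity [G] at [a = sigma^2]; [fG a - fG b] lies pointwise below
    [mono_integrand a b]. *)
Let fG (a : R) z := 2 * a^-1 * ind a z + (a^-1 * (ind a z * (N z * h z)) +
  8^-1 * (ind a z * h z ^+ 2)).
Let G (a : R) := 2 * a^-1 * M a + (a^-1 * IN a + 8^-1 * Ih a).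

Let hG (a : R) : has_integral mu (fG a) (G a).
Proof. by do !apply: has_integralD; apply: has_integralZ. Qed.

Let Ns_le z : 0 < s z -> (N z / s z) ^+ 2 <= (s z)^-1.
Proof.
move=> s0; rewrite exprMn exprVn ler_pdivrMr ?exprn_gt0//.
by rewrite (expr2 (s z)) mulKf ?gt_eqF.
Qed.

(* Completing the square:
   [2 (N/s)^2 + N h / s + h^2 / 8 = 2 (N/s + h/4)^2]. *)
Let G_mono (a b : R) : 0 < a -> a < b -> b <= a0 -> G a <= G b.
Proof.
move=> a1 ab ba.
have := has_integral_le (has_integralD (hG a) (has_integralZ (-1) (hG b)))
  (hPhi a1 (ltW (lt_le_trans ab ba)) ab).
rewrite B0_eq0// mulN1r subr_le0; apply => z.
rewrite /fG /sublevel /mono_integrand.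
case: (leP (s z) a) => sa.
  by rewrite (le_trans sa (ltW ab)); lra.
case: (leP (s z) b) => sb; last lra.
have := sqr_ge0 (N z / s z + h z / 4).
rewrite sqrrD; lra.
Qed.

Let M_ge0 (a : R) : 0 <= M a.
Proof. by apply: Rintegral_ge0 => z _; rewrite /sublevel; case: ifP. Qed.

Let Ih_ge0 (a : R) : 0 <= Ih a.
Proof.
by apply: Rintegral_ge0 => z _; rewrite mulr_ge0 ?sqr_ge0// /sublevel; case: ifP.
Qed.

Let IaN_ge0 (a : R) : 0 <= IaN a.
Proof.
by apply: Rintegral_ge0 => z _; rewrite mulr_ge0// /sublevel; case: ifP.
Qed.

(* Young's inequality [|N h| / a <= e N^2 / a^2 + h^2 / (4 e)] on [s <= a] *)
Let IaN_le (e a : R) : 0 < e -> 0 < a ->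
  a^-1 * IaN a <= e * (a^-1 * M a) + (4 * e)^-1 * Ih a.
Proof.
move=> e0 a1; rewrite mulrA.
apply: (has_integral_le (has_integralZ _ (haN a))
  (has_integralD (has_integralZ _ (hM a)) (has_integralZ _ (hh a)))) => z.
rewrite /sublevel; case: ifPn => sa; last by rewrite !(mul0r, mulr0) addr0.
rewrite !mul1r mulr1.
have ia : 0 < a^-1 by rewrite invr_gt0.
have ie : 0 < e^-1 by rewrite invr_gt0.
have N2 : (N z / a) ^+ 2 <= a^-1.
  rewrite exprMn exprVn ler_pdivrMr ?exprn_gt0// (expr2 a) mulKf ?gt_eqF//.
  exact: le_trans sa.
rewrite normrM.
have : (`|N z| / a) ^+ 2 <= a^-1.
  by rewrite exprMn real_normK ?num_real// -exprMn.
rewrite -(real_normK (num_real (h z))) => u2.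
have : 0 <= e^-1 * (e * (`|N z| / a) - `|h z| / 2) ^+ 2.
  by rewrite mulr_ge0 ?sqr_ge0// ltW.
have -> : e^-1 * (e * (`|N z| / a) - `|h z| / 2) ^+ 2 =
    e * (`|N z| / a) ^+ 2 + (4 * e)^-1 * `|h z| ^+ 2 - a^-1 * (`|N z| * `|h z|).
  by field; rewrite !gt_eqF.
nra.
Qed.

Let IN_norm (a : R) : `|IN a| <= IaN a.
Proof.
apply: (le_trans (le_normr_Rintegral measurableT (i_Nh' a))).
apply: le_Rintegral => //; first exact: rintegrable_norm.
by move=> z _; rewrite normrM /sublevel; case: ifP; rewrite (normr1, normr0).
Qed.

Let C0 := G a0 + Ih a0.

Let Ih_mono (a b : R) : a <= b -> Ih a <= Ih b.
Proof.
move=> ab; apply: (has_integral_le (hh a) (hh b)) => z; rewrite /sublevel.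
case: ifPn => sa; first by rewrite (le_trans sa ab).
by case: ifP; rewrite mul0r ?mul1r// sqr_ge0.
Qed.

(** With [e = 1] in [IaN_le], the mixed term uses up only one of the two copies of [M a / a] in
    [G a]; the other is bounded through [G a <= G a0]. *)
Let M_le (a : R) : 0 < a -> a <= a0 -> a^-1 * M a <= C0.
Proof.
move=> a1; rewrite le_eqVlt => aa.
have : G a <= G a0.
  by case/predU1P: aa => [->//|aa]; exact: G_mono.
have aa' : a <= a0 by rewrite le_eqVlt.
have := IaN_le ltr01 a1; have := IN_norm a; rewrite ler_norml => /andP[H1 _].
have := Ih_mono aa'; have := Ih_ge0 a; rewrite /C0 {1}/G.
have ia : 0 < a^-1 by rewrite invr_gt0.
have : - (a^-1 * IaN a) <= a^-1 * IN a by rewrite -mulrN ler_pM2l.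
lra.
Qed.

(** Bounded density ratios give [M 0 <= M a <= a C0] for all small [a], so the center has measure
    zero. *)
Let s_gt0_ae : {ae mu, forall z, 0 < s z}.
Proof.
have m0 : M 0 <= 0.
  apply/ler_addgt0Pl => e e0; rewrite addr0.
  pose a := Num.min a0 (e / (`|C0| + 1)).
  have a1 : 0 < a by rewrite lt_min a0_gt0 divr_gt0.
  have aa : a <= a0 by rewrite ge_min lexx.
  have ae : a * (`|C0| + 1) <= e by rewrite -ler_pdivlMr// ge_min lexx orbT.
  have : M 0 <= M a.
    apply: (has_integral_le (hM 0) (hM a)) => z; rewrite /sublevel.
    by case: ifPn => [z0|_]; [rewrite (le_trans z0 (ltW a1))|case: ifP].
  move/le_trans; apply; apply: le_trans ae.
  rewrite -ler_pdivrMl// (le_trans (M_le a1 aa))//.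
  by rewrite (le_trans (ler_norm _))// lerDl.
have mu0 : mu [set z | (s z <= 0)%R] = 0%E.
  rewrite -integral_sublevel -(fineK (integrable_fin_num measurableT (i_ind 0))).
  by congr EFin; apply/eqP; rewrite eq_le m0 M_ge0.
exists [set z | s z <= 0]; split => //; first exact: measurable_sublevel_set.
by move=> z /= /negP; rewrite -leNgt.
Qed.

(** Dominated convergence: the indicators tend to 0 wherever [s > 0], that is, almost everywhere. *)
Let small F : (forall b, mu.-integrable setT (EFin \o (fun z => ind b z * F z))) ->
  \int[mu]_z (ind a z * F z) @[a --> 0^'+] --> (0 : R).
Proof.
move=> iF; apply/cvg_at_rightP => u [u0 ucv].
(* A common bound on the radii provides one dominating function for the whole sequence. *)
have [K uK] : exists K, forall n, u n <= K.
  have [K [_ HK]] := cvg_seq_bounded (cvgP _ ucv).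
  exists (K + 1) => n; rewrite (le_trans (ler_norm _))//.
  by apply: (HK (K + 1)) => //; rewrite ltrDl.
have [] // := @cvg_Rintegral_dominated _ _ _ mu
   (fun n z => ind (u n) z * F z) (cst 0) (fun z => `|ind K z * F z|).
- by move=> n; exact: rintegrable_measurable (iF _).
- apply: filterS s_gt0_ae => z sz.
  apply: (@cvg_near_cst _ _ _ _ _ _) => //.
  have /cvgrPdist_lt /(_ _ sz) := ucv; apply: filterS => n /=.
  rewrite sub0r normrN gtr0_norm// /sublevel => us.
  by rewrite leNgt us /= mul0r.
- exact: rintegrable_norm.
- apply: aeW => z n; rewrite !normrM ler_wpM2r// /sublevel.
  case: ifPn => sa; first by rewrite (le_trans sa (uK n)).
  by rewrite normr0.
by move=> _; rewrite Rintegral_cst// mul0r.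
Qed.

Let cvg_Ih : Ih a @[a --> 0^'+] --> (0 : R).
Proof. exact: (small i_h2). Qed.

Let cvg_IaN : a^-1 * IaN a @[a --> 0^'+] --> (0 : R).
Proof.
apply/cvgrPdist_le => e e0.
have C1 : 0 < `|C0| + 1 by rewrite ltr_wpDl.
(* In Young's inequality this [k] makes the term in [M] at most [e / 2], by [M_le]; the term in
   [h^2] is at most [e / 2] once [Ih a <= 2 k e]. *)
pose k := e / (2 * (`|C0| + 1)).
have k0 : 0 < k by rewrite divr_gt0// mulr_gt0.
have /cvgrPdist_le /(_ (2 * k * e)) := cvg_Ih.
move=> /(_ (mulr_gt0 (mulr_gt0 (ltr0Sn _ 1) k0) e0)) nIh.
near=> a.
have a1 : 0 < a by near: a; exact: nbhs_right_gt.
have aa : a <= a0 by near: a; exact: nbhs_right_le.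
have : `|0 - Ih a| <= 2 * k * e by near: a; exact: nIh.
rewrite !sub0r !normrN !ger0_norm ?Ih_ge0//; last first.
  by rewrite mulr_ge0 ?IaN_ge0// invr_ge0 ltW.
move=> Hh; rewrite (le_trans (IaN_le k0 a1))//.
have H1 : (4 * k)^-1 * Ih a <= e / 2.
  by rewrite ler_pdivrMl ?mulr_gt0//; lra.
have H2 : k * (a^-1 * M a) <= k * (`|C0| + 1).
  rewrite ler_wpM2l ?(ltW k0)// (le_trans (M_le a1 aa))//.
  by rewrite (le_trans (ler_norm _))// lerDl.
have H3 : k * (`|C0| + 1) = e / 2 by rewrite /k; field; rewrite gt_eqF.
lra.
Unshelve. all: by end_near. Qed.

Let cvg_IN : a^-1 * IN a @[a --> 0^'+] --> (0 : R).
Proof.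
apply: norm_cvg0.
apply: (@squeeze_cvgr _ _ _ _ (cst 0) (fun a => a^-1 * IaN a)) => //;
  last exact: cvg_cst.
near=> a; have a1 : 0 < a by near: a; exact: nbhs_right_gt.
rewrite normr_ge0/= normrM gtr0_norm ?invr_gt0// ler_pM2l ?invr_gt0//; exact: IN_norm.
Unshelve. all: by end_near. Qed.

Lemma sublevel_ratio_cvg :
  exists L : R, a^-1 * (\int[mu]_z sublevel a z) @[a --> 0^'+] --> L.
Proof.
have cG : G a @[a --> 0^'+] --> inf (G @` `]0, a0]%classic).
  apply: (@nondecreasing_at_right_cvgr _ G 0 (BRight a0)).
  - by rewrite bnd_simp.
  - move=> x y; rewrite !in_itv /= => /andP[x0 xa] /andP[y0 ya].
    have [-> //|xy le_xy] := eqVneq x y.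
    by apply: G_mono => //; rewrite lt_neqAle xy.
  (* Young's inequality with [e = 1] leaves [G a >= M a / a - Ih a / 8], which is bounded below. *)
  exists (- Ih a0) => _ [a + <-]; rewrite /= in_itv /= => /andP[a1 aa].
  have := IaN_le ltr01 a1; have := IN_norm a; rewrite ler_norml => /andP[H1 _].
  have := Ih_mono aa; have := Ih_ge0 a; rewrite /G.
  have ia : 0 < a^-1 by rewrite invr_gt0.
  have : - (a^-1 * IaN a) <= a^-1 * IN a by rewrite -mulrN ler_pM2l.
  have : 0 <= a^-1 * M a by rewrite mulr_ge0// ltW.
  lra.
exists (2^-1 * (inf (G @` `]0, a0]%classic) - 0 - 8^-1 * 0)).
have -> : (fun a => a^-1 * (\int[mu]_z sublevel a z)) =
    (fun a => 2^-1 * (G a - a^-1 * IN a - 8^-1 * Ih a)).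
  by apply/funext => a; rewrite /G -/(M a); move: (a^-1) => u; field.
apply: cvgM; first exact: cvg_cst.
apply: cvgB; first exact: cvgB.
by apply: cvgM => //; exact: cvg_cst.
Qed.

(** * Square integrability of [N / s] up to the center *)

Let fF (a : R) z := 2 * a^-1 * ind a z + a^-1 * (ind a z * (N z * h z)).

Let hF (a : R) : has_integral mu (fF a) (2 * a^-1 * M a + a^-1 * IN a).
Proof. by apply: has_integralD; apply: has_integralZ. Qed.

Let Ns2 (a : R) z := (ind a0 z - ind a z) * (N z / s z) ^+ 2.

Let mind (a : R) : measurable_fun setT (ind a).
Proof. exact: measurable_sublevel. Qed.

Let mNs2 (a : R) : measurable_fun setT (Ns2 a).
Proof.
apply: measurable_funM; first exact: measurable_funB.
exact: measurable_funX.
Qed.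

Let i_Ns2a (a : R) : 0 < a -> a <= a0 -> mu.-integrable setT (EFin \o Ns2 a).
Proof.
move=> a1 aa.
apply: rintegrable_le (rintegrableZl a^-1 (i_ind a0)) _ => // z.
rewrite /Ns2 /sublevel; case: (leP (s z) a) => sa.
  by rewrite (le_trans sa aa) subrr mul0r normr0 mulr1 invr_ge0 ltW.
rewrite subr0; case: ifP => _; last by rewrite mul0r normr0 mulr0.
rewrite mul1r mulr1 ger0_norm ?sqr_ge0// (le_trans (Ns_le (lt_trans a1 sa)))//.
by rewrite lef_pV2// ?ltW// posrE// (lt_trans a1).
Qed.

Let C2 := 2 * a0^-1 * M a0 + a0^-1 * IN a0 + Ih a0.

(** Only one of the two copies of [(N/s)^2] in [mono_integrand] is spent on the square
    [(N/s + h/2)^2]; the other is what gets integrated. As [B0 a0 = 0], the bound does not depend on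
    [a]. *)
Let I_Ns2a_le (a : R) : 0 < a -> a < a0 -> \int[mu]_z Ns2 a z <= C2.
Proof.
move=> a1 aa.
have := has_integral_le (has_integralD (has_integralI (i_Ns2a a1 (ltW aa)))
   (has_integralD (has_integralZ (-1) (hF a0)) (has_integralZ (- 2^-1) (hh a0))))
  (hPhi a1 (ltW aa) aa).
rewrite B0_eq0// => H; suff : \int[mu]_z Ns2 a z +
    (-1 * (2 / a0 * M a0 + a0^-1 * IN a0) + - 2^-1 * Ih a0) <= 0.
  by have := Ih_ge0 a0; rewrite /C2; lra.
apply: H => z; rewrite /Ns2 /fF /sublevel /mono_integrand.
case: (leP (s z) a) => sa.
  rewrite (le_trans sa (ltW aa)).
  have ia : 0 < a^-1 by rewrite invr_gt0.
  have N2 : (N z / a) ^+ 2 <= a^-1.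
    rewrite exprMn exprVn ler_pdivrMr ?exprn_gt0// (expr2 a) mulKf ?gt_eqF//.
    exact: le_trans sa.
  have := sqr_ge0 (N z / a + h z / 2); rewrite sqrrD.
  have := sqr_ge0 (h z).
  lra.
case: (leP (s z) a0) => sb; last lra.
have := sqr_ge0 (N z / s z + h z / 2); have := sqr_ge0 (h z).
rewrite sqrrD; lra.
Qed.

Let i_Ns2_a0 : mu.-integrable setT (EFin \o (fun z => ind a0 z * (N z / s z) ^+ 2)).
Proof.
apply/integrableP; split.
  apply/measurable_EFinP/measurable_funM => //; exact: measurable_funX.
(* The factor [1/2] keeps the radii strictly below [a0], as [I_Ns2a_le] demands. *)
pose u (n : nat) := a0 / 2 * n.+1%:R^-1.
have u0 n : 0 < u n by rewrite !divr_gt0.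
have ua n : u n < a0.
  have w1 : n.+1%:R^-1 <= 1 :> R by rewrite invf_le1// ler1n.
  rewrite (@le_lt_trans _ _ (a0 / 2))//; last by have := a0_gt0; lra.
  by rewrite -[leRHS]mulr1 ler_pM2l// divr_gt0.
have Ns2_ge0 a z : a <= a0 -> 0 <= Ns2 a z.
  move=> aa; rewrite mulr_ge0 ?sqr_ge0// subr_ge0 /sublevel.
  by case: ifPn => [sa|_]; [rewrite (le_trans sa aa)|case: ifP].
have := @cvg_monotone_convergence _ _ _ mu setT measurableT
  (fun n z => (Ns2 (u n) z)%:E).
move=> H; have Hlim z : limn (fun n => (Ns2 (u n) z)%:E) =
    `|(ind a0 z * (N z / s z) ^+ 2)%:E|%E.
  rewrite gee0_abs; last first.
    by rewrite lee_fin mulr_ge0 ?sqr_ge0// /sublevel; case: ifP.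
  apply: cvg_lim => //; apply: cvg_near_cst.
  (* At [s z = 0] both sides vanish because [0^-1 = 0], so the convergence holds everywhere. *)
  have [sz|sz] := ltP 0 (s z); last first.
    have s_eq0 : s z = 0 by apply/eqP; rewrite eq_le sz s_ge0.
    by apply: nearW => n; rewrite /Ns2 s_eq0 invr0 mulr0 expr0n !mulr0.
  have k0 : 0 < s z / a0 by rewrite divr_gt0.
  near=> n; congr EFin; rewrite /Ns2 /sublevel.
  have un : u n < s z.
    have : n.+1%:R^-1 < s z / a0 by near: n; exact: near_infty_natSinv_lt (PosNum k0).
    by rewrite ltr_pdivlMr//; have := u0 n; rewrite /u; move: (n.+1%:R^-1) => w; lra.
  by rewrite [s z <= u n]leNgt un /= subr0.
have {}H : (\int[mu]_z (Ns2 (u n) z)%:E @[n --> \oo] -->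
    \int[mu]_z `|(ind a0 z * (N z / s z) ^+ 2)%:E|)%E.
  under [X in _ --> X]eq_integral do rewrite -Hlim.
  apply: H.
  - by move=> n; exact/measurable_EFinP.
  - by move=> n z _; rewrite lee_fin Ns2_ge0// ltW.
  - move=> z _ n m nm; rewrite lee_fin ler_wpM2r ?sqr_ge0// lerB//.
    have umn : u m <= u n.
      by rewrite ler_pM2l ?divr_gt0// lef_pV2 ?posrE// ler_nat.
    rewrite /sublevel; case: ifPn => sm; first by rewrite (le_trans sm umn).
    by case: ifP.
rewrite (@le_lt_trans _ _ C2%:E) ?ltry//.
rewrite -(cvg_lim _ H)//; apply: lime_le; first exact: cvgP H.
apply: nearW => n; have iu := i_Ns2a (u0 n) (ltW (ua n)).
rewrite -(fineK (integrable_fin_num measurableT iu)) lee_fin.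
exact: I_Ns2a_le.
Unshelve. all: by end_near. Qed.

Let i_Ns2 (b : R) :
  mu.-integrable setT (EFin \o (fun z => ind b z * (N z / s z) ^+ 2)).
Proof.
apply: rintegrable_le (rintegrableD i_Ns2_a0 (rintegrableZl a0^-1 (i_ind b))) _.
  by apply: measurable_funM => //; exact: measurable_funX.
move=> z; have N2 := sqr_ge0 (N z / s z).
have ia : 0 < a0^-1 by rewrite invr_gt0.
rewrite /sublevel; case: (leP (s z) b) => sb; last first.
  by rewrite mul0r normr0 mulr0 addr0; case: ifP => _; rewrite ?mul1r ?mul0r.
rewrite mul1r ger0_norm// mulr1; case: ifPn => sa.
  by rewrite mul1r lerDl ltW.
rewrite -ltNge in sa; rewrite mul0r add0r (le_trans (Ns_le _))//.
  exact: lt_trans sa.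
by rewrite lef_pV2// ?ltW// posrE// (lt_trans a0_gt0).
Qed.

Let i_Ns (b : R) :
  mu.-integrable setT (EFin \o (fun z => ind b z * (N z / s z))).
Proof.
apply: rintegrable_le (rintegrableD (i_Ns2 b) (i_ind b)) _.
  exact: measurable_funM.
move=> z; rewrite /sublevel; case: ifPn => sb; last first.
  by rewrite !mul0r normr0 addr0.
rewrite !mul1r.
have := sqr_ge0 (N z / s z - 1); have := sqr_ge0 (N z / s z + 1).
rewrite sqrrD sqrrB ler_norml => *; apply/andP; split; lra.
Qed.

(** Ensures that the [c0]-integral of the final inequality converges at the center. *)
Lemma integrable_weighted_normal (b : R) : mu.-integrable setT
  (EFin \o (fun z => sublevel b z * ((b^-1 - (s z)^-1) * N z))).
Proof.
rewrite (_ : (fun z => _) = (fun z =>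
    b^-1 * (ind b z * N z) + -1 * (ind b z * (N z / s z)))).
  by apply: rintegrableD; exact: rintegrableZl.
apply/funext => z; move: (s z)^-1 b^-1 => u v; ring.
Qed.

Let i_aNs (b : R) :
  mu.-integrable setT (EFin \o (fun z => ind b z * `|N z / s z|)).
Proof.
rewrite (_ : (fun z => _) = (fun z => `|ind b z * (N z / s z)|)).
  exact: rintegrable_norm.
apply/funext => z; rewrite [RHS]normrM /sublevel.
by case: ifP; rewrite (normr1, normr0).
Qed.

(** On the annulus the [c0]-part of [N h] cancels against the [c0]-integral, and what remains is
    [2 (N/s + g/4)^2] plus the nonnegative [(|N g| - N g) / b]. The corrections on the inner ball
    vanish as [a] tends to 0. *)
Lemma sublevel_ratio_le (L b : R) : 0 < b ->
  a^-1 * (\int[mu]_z sublevel a z) @[a --> 0^'+] --> L ->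
  2 * L <= 2 * b^-1 * (\int[mu]_z sublevel b z)
    + (8^-1 * (\int[mu]_z g z ^+ 2)
    + (b^-1 * (\int[mu]_z (sublevel b z * `|N z * g z|))
    + (c0 * (\int[mu]_z (sublevel b z * ((b^-1 - (s z)^-1) * N z)))
    + B0 b))).
Proof.
move=> b0 cL.
(* Pays for [c0 N / s] on the inner ball: the [c0]-integral extends to the center, whereas
   [mono_integrand] has no such term there. *)
pose W a := \int[mu]_z (ind a z * `|N z / s z|).
set X := (X in _ <= X).
have cW : W a @[a --> 0^'+] --> (0 : R) by exact: (small i_aNs).
have HX : \forall a \near 0^'+,
    2 * (a^-1 * M a) - a^-1 * IaN a - `|c0| * W a <= X.
  near=> a.
  have a1 : 0 < a by near: a; exact: nbhs_right_gt.
  have aa : a <= a0 by near: a; exact: nbhs_right_le.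
  have ab : a < b by near: a; exact: nbhs_right_lt.
  have HL := has_integralD (has_integralZ (2 * a^-1) (hM a)) (has_integralD
    (has_integralZ (- a^-1) (haN a))
    (has_integralZ (- `|c0|) (has_integralI (i_aNs a)))).
  have HR := has_integralD (has_integralZ (2 * b^-1) (hM b)) (has_integralD
    (has_integralZ 8^-1 (has_integralI g2_int)) (has_integralD
    (has_integralZ b^-1 (has_integralI (i_Ng b))) (has_integralD
    (has_integralZ c0 (has_integralI (integrable_weighted_normal b)))
    (hPhi a1 aa ab)))).
  have H := has_integral_le HL HR.
  rewrite /X -/(M b) (le_trans _ (H _))//; first by rewrite -/(W a); lra.
  move=> z; rewrite /sublevel /mono_integrand.
  have ia : 0 < a^-1 by rewrite invr_gt0.
  have ib : 0 < b^-1 by rewrite invr_gt0.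
  have iab : b^-1 < a^-1 by rewrite ltf_pV2.
  have hE : h z = g z + c0 by rewrite /g subrK.
  have g2 := sqr_ge0 (g z).
  have Ng0 : N z * g z <= `|N z * g z| by exact: ler_norm.
  have Ng1 : - (N z * g z) <= `|N z * g z| by rewrite -normrN ler_norm.
  have Nh1 : - (N z * h z) <= `|N z * h z| by rewrite -normrN ler_norm.
  case: (leP (s z) a) => sa.
    rewrite (le_trans sa (ltW ab)).
    have c1 : c0 * (N z / s z) <= `|c0| * `|N z / s z| by rewrite -normrM ler_norm.
    have : - (a^-1 * (N z * h z)) <= a^-1 * `|N z * h z| by rewrite -mulrN ler_pM2l.
    have : b^-1 * (N z * g z) <= b^-1 * `|N z * g z| by rewrite ler_pM2l.
    move: c1; move: `|N z * h z| `|N z * g z| `|N z / s z| `|c0| => p q r t.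
    rewrite hE; move: (a^-1) (b^-1) ((s z)^-1) g2 => u v w.
    lra.
  case: (leP (s z) b) => sb; last lra.
  have : b^-1 * (N z * g z) <= b^-1 * `|N z * g z| by rewrite ler_pM2l.
  have := sqr_ge0 (N z / s z + g z / 4); rewrite sqrrD hE.
  move: `|N z * (g z + c0)| `|N z * g z| `|N z / s z| `|c0| => p q r t.
  move: (a^-1) (b^-1) ((s z)^-1) => u v w.
  lra.
have cX : 2 * (a^-1 * M a) - a^-1 * IaN a - `|c0| * W a @[a --> 0^'+] -->
    2 * L - 0 - `|c0| * 0.
  apply: cvgB; last by apply: cvgM => //; exact: cvg_cst.
  by apply: cvgB => //; apply: cvgM => //; exact: cvg_cst.
have : lim (2 * (a^-1 * M a) - a^-1 * IaN a - `|c0| * W a @[a --> 0^'+]) <= X.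
  by apply: limr_le => //; exact: cvgP cX.
by rewrite (cvg_lim _ cX)// mulr0 !subr0.
Unshelve. all: by end_near. Qed.

(* Only the excess over [e / b] is dominated by a fixed integrable function,
   namely [g^2 / (4 e)]; the part below costs at most [e C]. *)
Lemma sublevel_error_cvg (C b1 : R) :
  (forall b, b1 <= b -> b^-1 * (\int[mu]_z sublevel b z) <= C) ->
  b^-1 * (\int[mu]_z (sublevel b z * `|N z * g z|)) @[b --> +oo] --> (0 : R).
Proof.
move=> MC.
pose r (e b : R) z := Num.max 0 (ind b z * (b^-1 * `|N z * g z| - e * b^-1)).
have cr e : 0 < e -> \int[mu]_z r e b z @[b --> +oo] --> (0 : R).
  move=> e0; apply/cvg_pinftyP => u uoo.
  have rE b z : r e b z <= (4 * e)^-1 * g z ^+ 2.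
    have ie : 0 < (4 * e)^-1 by rewrite invr_gt0 mulr_gt0.
    have G0 : 0 <= (4 * e)^-1 * g z ^+ 2 by rewrite mulr_ge0 ?sqr_ge0 ?ltW.
    rewrite ge_max G0/= /sublevel; case: ifPn => [sb|_]; last by rewrite mul0r.
    (* Since [0 <= s z <= b], only [b = 0] is left here, where [b^-1 = 0]. *)
    have [b_le0|b0] := leP b 0.
      have -> : b = 0 by apply/eqP; rewrite eq_le b_le0 (le_trans (s_ge0 z)).
      by rewrite invr0 mul0r mulr0 subr0 mulr0.
    rewrite mul1r normrM.
    have N2 : (`|N z| / b) ^+ 2 <= b^-1.
      rewrite exprMn real_normK ?num_real// exprVn ler_pdivrMr ?exprn_gt0//.
      by rewrite (expr2 b) mulKf ?gt_eqF// (le_trans (N_le_s z)).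
    rewrite -(real_normK (num_real (g z))).
    have : 0 <= e^-1 * (e * (`|N z| / b) - `|g z| / 2) ^+ 2.
      by rewrite mulr_ge0 ?sqr_ge0// ltW// invr_gt0.
    have -> : e^-1 * (e * (`|N z| / b) - `|g z| / 2) ^+ 2 =
      e * (`|N z| / b) ^+ 2 + (4 * e)^-1 * `|g z| ^+ 2 - b^-1 * (`|N z| * `|g z|).
      by field; rewrite !gt_eqF.
    nra.
  have r0 b z : 0 <= r e b z by rewrite le_max lexx.
  have [] // := @cvg_Rintegral_dominated _ _ _ mu (fun n z => r e (u n) z)
    (cst 0) (fun z => (4 * e)^-1 * g z ^+ 2).
  - move=> n; apply: measurable_maxr => //; apply: measurable_funM => //.
    apply: measurable_funB => //; apply: measurable_funM => //.
    by apply: measurableT_comp => //; exact: measurable_funM.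
  - apply: aeW => z; apply: (@squeeze_cvgr _ _ _ _ (cst 0)
      (fun n => (u n)^-1 * `|N z * g z|)).
    + near=> n; rewrite r0/= ge_max.
      have un : 0 < (u n)^-1.
        by rewrite invr_gt0; near: n; exact: (cvgry_gt uoo).
      rewrite (mulr_ge0 (ltW un))//= /sublevel; case: ifP => _.
        by rewrite mul1r lerBlDr lerDl mulr_ge0// ltW.
      by rewrite mul0r mulr_ge0// ltW.
    + exact: cvg_cst.
    + rewrite -[X in _ --> X](mul0r `|N z * g z|); apply: cvgM; last exact: cvg_cst.
      by apply/gtr0_cvgV0 => //; exact: (cvgry_gt uoo).
  - exact: rintegrableZl.
  - by apply: aeW => z n; rewrite ger0_norm.
  by move=> _; rewrite Rintegral_cst// mul0r.
apply/cvgrPdist_le => e e0.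
have C1 : 0 < `|C| + 1 by rewrite ltr_wpDl.
pose k := e / (2 * (`|C| + 1)).
have k0 : 0 < k by rewrite divr_gt0// mulr_gt0.
have e2 : 0 < e / 2 by rewrite divr_gt0.
have /cvgrPdist_le /(_ _ e2) cre := cr k k0.
near=> b.
have b0 : 0 < b by near: b; exact: nbhs_pinfty_gt.
have ib : 0 < b^-1 by rewrite invr_gt0.
have bb1 : b1 <= b by near: b; apply: nbhs_pinfty_ge; rewrite num_real.
have : `|0 - \int[mu]_z r k b z| <= e / 2 by near: b; exact: cre.
have rk_ge0 z : 0 <= r k b z by rewrite le_max lexx.
have IaNg_ge0 : 0 <= \int[mu]_z (ind b z * `|N z * g z|).
  by apply: Rintegral_ge0 => z _; rewrite mulr_ge0// /sublevel; case: ifP.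
rewrite !sub0r !normrN (ger0_norm (mulr_ge0 (ltW ib) IaNg_ge0)).
rewrite ger0_norm ?Rintegral_ge0// => Hr.
have i_r : mu.-integrable setT (EFin \o r k b).
  apply: rintegrable_le (rintegrableZl b^-1 (i_Ng b)) _.
    apply: measurable_maxr => //; apply: measurable_funM => //.
    apply: measurable_funB => //; apply: measurable_funM => //.
    by apply: measurableT_comp => //; exact: measurable_funM.
  move=> z; rewrite ger0_norm// ge_max /sublevel; case: ifPn => _.
    by rewrite !mul1r (mulr_ge0 (ltW ib))//= lerBlDr lerDl (mulr_ge0 (ltW k0) (ltW ib)).
  by rewrite !mul0r mulr0 lexx.
have := has_integral_le (has_integralZ b^-1 (has_integralI (i_Ng b)))
  (has_integralD (has_integralZ (k * b^-1) (hM b)) (has_integralI i_r)).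
move=> /(_ _)/le_trans; apply.
  move=> z; rewrite /r /sublevel; case: ifPn => _.
    by rewrite !mul1r mulr1 -lerBlDl le_max lexx orbT.
  by rewrite !mul0r !mulr0 add0r le_max lexx.
have H2 : k * (b^-1 * M b) <= k * (`|C| + 1).
  rewrite ler_wpM2l ?(ltW k0)// (le_trans (MC _ bb1))//.
  by rewrite (le_trans (ler_norm _))// lerDl.
have H3 : k * (`|C| + 1) = e / 2 by rewrite /k; field; rewrite gt_eqF.
lra.
Unshelve. all: by end_near. Qed.

End monotonicity.

(** * Euclidean geometry of oriented planes in R^3 *)

Section euclidean_space.
Context (R : realType).
Implicit Types (u v w x : 'rV[R]_3) (c : R) (xi : 'M[R]_3).

Lemma forall_I3 (P : 'I_3 -> Prop) : P 0 -> P 1 -> P 2 -> forall i, P i.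
Proof.
move=> P0 P1 P2 [[|[|[|//]]] i3].
- by rewrite (_ : Ordinal _ = 0)//; exact: val_inj.
- by rewrite (_ : Ordinal _ = 1)//; exact: val_inj.
- by rewrite (_ : Ordinal _ = 2)//; exact: val_inj.
Qed.

Lemma sum_I3 (F : 'I_3 -> R) : \sum_(i < 3) F i = F 0 + F 1 + F 2.
Proof.
rewrite !big_ord_recl big_ord0 addr0 addrA.
by congr (F _ + F _ + F _); exact: val_inj.
Qed.

Lemma dotE u v : dot u v = u 0 0 * v 0 0 + u 0 1 * v 0 1 + u 0 2 * v 0 2.
Proof. exact: sum_I3. Qed.

Lemma dotC u v : dot u v = dot v u.
Proof. by rewrite !dotE; ring. Qed.

Lemma dotDl u v w : dot (u + v) w = dot u w + dot v w.
Proof. by rewrite !dotE !mxE; ring. Qed.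

Lemma dotZl c u v : dot (c *: u) v = c * dot u v.
Proof. by rewrite !dotE !mxE; ring. Qed.

Lemma dotBl u v w : dot (u - v) w = dot u w - dot v w.
Proof. by rewrite !dotE !mxE; ring. Qed.

Lemma dotDr u v w : dot w (u + v) = dot w u + dot w v.
Proof. by rewrite dotC dotDl !(dotC w). Qed.

Lemma dotZr c u v : dot u (c *: v) = c * dot u v.
Proof. by rewrite dotC dotZl dotC. Qed.

Lemma dot_ge0 u : 0 <= dot u u.
Proof. by rewrite dotE !addr_ge0// -expr2 sqr_ge0. Qed.

Lemma dot_eq0 u : dot u u = 0 -> u = 0.
Proof.
rewrite dotE => u0.
have H0 := sqr_ge0 (u 0 0); have H1 := sqr_ge0 (u 0 1).
have H2 := sqr_ge0 (u 0 2).
have E i : u 0 i ^+ 2 = 0 -> u 0 i = 0 by move/eqP; rewrite sqrf_eq0 => /eqP.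
by apply/rowP; apply: forall_I3; rewrite mxE; apply: E; lra.
Qed.

Lemma enorm_ge0 u : 0 <= enorm u. Proof. exact: sqrtr_ge0. Qed.

Lemma sqr_enorm u : enorm u ^+ 2 = dot u u.
Proof. by rewrite sqr_sqrtr// dot_ge0. Qed.

Lemma starE xi : (star xi 0 0 = xi 1 2) * (star xi 0 1 = xi 2 0) *
  (star xi 0 2 = xi 0 1).
Proof. by rewrite !mxE; do !split; congr (xi _ _); exact: val_inj. Qed.

Lemma dot_cauchy_schwarz u v : dot u v ^+ 2 <= dot u u * dot v v.
Proof.
rewrite !dotE -subr_ge0.
rewrite [X in 0 <= X](_ : _ = (u 0 0 * v 0 1 - u 0 1 * v 0 0) ^+ 2 +
  (u 0 0 * v 0 2 - u 0 2 * v 0 0) ^+ 2 +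
  (u 0 1 * v 0 2 - u 0 2 * v 0 1) ^+ 2); last by ring.
by rewrite !addr_ge0// sqr_ge0.
Qed.

(** Orthonormality says [A A^T = 1] for the matrix with rows [a], [b], [c]; as [A] is square,
    [A^T A = 1], which is the completeness relation. *)
Lemma orthonormal_expansion (a b c x : 'rV[R]_3) :
  dot a a = 1 -> dot b b = 1 -> dot c c = 1 ->
  dot a b = 0 -> dot a c = 0 -> dot b c = 0 ->
  x = dot x a *: a + dot x b *: b + dot x c *: c.
Proof.
move=> aa bb cc ab ac bc.
pose A : 'M[R]_3 := \matrix_(i, j) [:: a 0 j; b 0 j; c 0 j]`_i.
have AAt : A *m A^T = 1%:M.
  apply/matrixP; apply: forall_I3; apply: forall_I3;
    rewrite !mxE sum_I3 !mxE/= -?dotE// ?(dotC b a) ?(dotC c a) ?(dotC c b)//.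
have /matrixP AtA := mulmx1C AAt.
have {AtA} E i j : a 0 i * a 0 j + b 0 i * b 0 j + c 0 i * c 0 j = (i == j)%:R.
  by have := AtA i j; rewrite !mxE sum_I3 !mxE.
apply/rowP => j; rewrite !mxE !dotE.
transitivity (x 0 0 * (0 == j)%:R + x 0 1 * (1 == j)%:R + x 0 2 * (2 == j)%:R).
  by move: j; apply: forall_I3; rewrite /=; ring.
by rewrite -!E; ring.
Qed.

(** The alternating array of [v /\ xi] has one coordinate up to sign, that of index [(0, 1, 2)], and
    this coordinate is the scalar product. *)
Lemma Go_set_plane xi : Go_set xi -> plane xi = [set v | dot v (star xi) = 0].
Proof.
move=> [[a [b ->]] _]; apply/seteqP; split => v /=.
  by move/(_ 0 1 2); rewrite /wedge12 dotE !starE.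
rewrite dotE !starE !mxE => v0.
by apply: forall_I3; apply: forall_I3; apply: forall_I3;
  rewrite /wedge12 !mxE; lra.
Qed.

Lemma Go_set_dot_star xi : Go_set xi -> dot (star xi) (star xi) = 1.
Proof.
move=> [[a [b xiE]]] /(congr1 (fun r => r ^+ 2)).
rewrite /norm2 sqr_sqrtr; last first.
  by rewrite sumr_ge0// => i _; rewrite sumr_ge0// => j _; rewrite sqr_ge0.
rewrite expr1n => <-; rewrite dotE !starE sum_I3.
do 3 rewrite [\sum_(j < 3 | _) _]big_mkcond sum_I3 /=.
rewrite xiE !mxE; ring.
Qed.

(** [e.1], [e.2] and [star xi] form an orthonormal basis. This removes the chosen basis from the
    tangential divergence. *)
Lemma orthonormal_plane_parseval xi e x : Go_set xi ->
  orthonormal_basis (plane xi) e ->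
  dot x e.1 ^+ 2 + dot x e.2 ^+ 2 = dot x x - dot x (star xi) ^+ 2.
Proof.
move=> Gxi [e11 e22 e12]; rewrite Go_set_plane// => pE.
have pd a b : dot (a *: e.1 + b *: e.2) (star xi) = 0.
  rewrite -[_ = 0]/([set v | dot v (star xi) = 0] (a *: e.1 + b *: e.2)) pE.
  by exists (a, b).
have e1 : dot e.1 (star xi) = 0.
  by have := pd 1 0; rewrite scale1r scale0r addr0.
have e2 : dot e.2 (star xi) = 0.
  by have := pd 0 1; rewrite scale1r scale0r add0r.
have xE := orthonormal_expansion x e11 e22 (Go_set_dot_star Gxi) e12 e1 e2.
rewrite {3}xE !dotDl !dotZl !(dotC _ x); ring.
Qed.

(** Excludes the default value of [xget] in [tangential_div]. The basis is [a = v / |v|] together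
    with [star xi] cross [a]; [v] is nonzero because [star xi] is a unit vector. *)
Lemma orthonormal_plane_exists xi : Go_set xi ->
  exists e, orthonormal_basis (plane xi) e.
Proof.
move=> Gxi; have n1 := Go_set_dot_star Gxi.
rewrite /orthonormal_basis Go_set_plane//.
have [[v [w xiE]] _] := Gxi.
have vn : dot v (star xi) = 0.
  by rewrite dotE !starE xiE !mxE; ring.
have v0 : 0 < dot v v.
  rewrite lt_neqAle dot_ge0 andbT eq_sym; apply/eqP => /dot_eq0 v0.
  move: n1; rewrite dotE !starE xiE v0 !mxE; lra.
pose r := enorm v.
have r0 : r != 0 by rewrite gt_eqF// sqrtr_gt0.
pose a := r^-1 *: v; pose b := cross (star xi) a.
have bE : (b 0 0 = star xi 0 1 * a 0 2 - star xi 0 2 * a 0 1) *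
    (b 0 1 = star xi 0 2 * a 0 0 - star xi 0 0 * a 0 2) *
    (b 0 2 = star xi 0 0 * a 0 1 - star xi 0 1 * a 0 0).
  by do !split; rewrite [LHS]mxE;
    congr (star xi 0 _ * a 0 _ - star xi 0 _ * a 0 _); exact: val_inj.
have aa : dot a a = 1.
  by rewrite dotZl dotZr -sqr_enorm -/r; field.
have an : dot a (star xi) = 0 by rewrite dotZl vn mulr0.
have ab : dot a b = 0 by rewrite dotE !bE; ring.
have bn : dot b (star xi) = 0 by rewrite dotE !bE; ring.
have bb : dot b b = 1.
  (* Lagrange's identity for the cross product. *)
  transitivity (dot (star xi) (star xi) * dot a a - dot a (star xi) ^+ 2).
    by rewrite !dotE !bE; ring.
  by rewrite n1 aa an expr0n/= mulr1 subr0.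
exists (a, b); split => //; apply/seteqP; split => x /=.
  move=> xn; exists (dot x a, dot x b) => //=.
  by rewrite [RHS](orthonormal_expansion x aa bb n1 ab an bn) xn scale0r addr0.
by move=> [[p q] _ <-]/=; rewrite dotDl (dotZl p a) (dotZl q b) an bn !mulr0 addr0.
Qed.

Lemma Go_valP (z : Go R) : Go_set (Go_val z).
Proof. by have := valP z; rewrite inE. Qed.

End euclidean_space.

(** * Radial test fields *)

Section radial_fields.
Context (R : realType).
Implicit Types (x v : 'rV[R]_3).

Lemma cvg_mx (T : Type) (F : set_system T) {FF : Filter F} (m n : nat)
    (M : T -> 'M[R]_(m, n)) (l : 'M[R]_(m, n)) :
  (forall i j, M x i j @[x --> F] --> l i j) -> M x @[x --> F] --> l.
Proof.
move=> Ml; apply/cvgrPdist_le => e e0; near=> x.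
rewrite /Num.Def.normr/= mx_normrE (bigmax_le _ (ltW e0))//= => i _.
rewrite !mxE/=.
move: i; near: x; apply: filter_forall => /= i.
exact: ((cvgrPdist_le _ _).1 (Ml i.1 i.2)).
Unshelve. all: by end_near. Qed.

Lemma is_diff_coord x (i : 'I_3) :
  is_diff x (fun z : 'rV[R]_3 => z 0 i : R) (fun v : 'rV[R]_3 => v 0 i).
Proof.
apply: DiffDef; first exact: differentiable_coord.
have @f : {linear 'rV[R]_3 -> R}.
  by exists (fun v : 'rV[R]_3 => v 0 i); do 2![eexists]; do ?[constructor];
     rewrite ?mxE// => ? *; rewrite ?mxE//; move=> ?; rewrite !mxE.
rewrite (_ : (fun _ => _) = f)//; apply: diff_lin; exact: coord_continuous.
Qed.

Let is_diff_sum3 (k0 k1 k2 dk0 dk1 dk2 : 'rV[R]_3 -> R) (a b c x : 'rV[R]_3) :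
  is_diff x k0 dk0 -> is_diff x k1 dk1 -> is_diff x k2 dk2 ->
  is_diff x ((fun z => k0 z *: a) + (fun z => k1 z *: b) + (fun z => k2 z *: c))
    ((fun v => dk0 v *: a) + (fun v => dk1 v *: b) + (fun v => dk2 v *: c)).
Proof.
have is_diffZl (k dk : 'rV[R]_3 -> R) (e : 'rV[R]_3) : is_diff x k dk ->
    is_diff x (fun z => k z *: e) (fun v => dk v *: e).
  move=> [dkx dkE]; apply: DiffDef; first exact: differentiableZl.
  by rewrite diffZl// dkE.
move=> d0 d1 d2.
exact: (is_diffD (is_diffD (is_diffZl _ _ a d0) (is_diffZl _ _ b d1))
  (is_diffZl _ _ c d2)).
Qed.

Variables (x0 : 'rV[R]_3) (phi dphi : R -> R).
Hypothesis phi_derive : forall t : R, is_derive t 1 phi (dphi t).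
Hypothesis dphi_cont : continuous dphi.

(** The profile takes the squared distance, a polynomial, so the field is differentiable at [x0] as
    well. *)
Definition radial_field x : 'rV[R]_3 := phi (dot (x - x0) (x - x0)) *: (x - x0).

Definition radial_diff x v : 'rV[R]_3 :=
  phi (dot (x - x0) (x - x0)) *: v +
  (2 * dphi (dot (x - x0) (x - x0)) * dot (x - x0) v) *: (x - x0).

Let y (i : 'I_3) : 'rV[R]_3 -> R := fun z => z 0 i - x0 0 i.

Let is_diff_y x i : is_diff x (y i) (fun v => v 0 i).
Proof.
have := is_diff_coord x i => di.
apply: (@is_diff_eq _ _ _ ((fun z : 'rV[R]_3 => z 0 i : R) - cst (x0 0 i)) _ _ x
  (is_diffB _ _)).
by rewrite subr0.
Qed.

Let s : 'rV[R]_3 -> R := fun z => dot (z - x0) (z - x0).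

Let sE : s = y 0 * y 0 + y 1 * y 1 + y 2 * y 2.
Proof. by apply/funext => z; rewrite /s dotE !mxE. Qed.

Let is_diff_s x : is_diff x s (fun v => 2 * dot (x - x0) v).
Proof.
rewrite sE.
apply: (is_diff_eq (is_diffD (is_diffD (is_diffM (is_diff_y x 0) (is_diff_y x 0))
  (is_diffM (is_diff_y x 1) (is_diff_y x 1)))
  (is_diffM (is_diff_y x 2) (is_diff_y x 2)))).
apply/funext => v; rewrite dotE !mxE /y.
rewrite -[LHS]/((x 0 0 - x0 0 0) * v 0 0 + (x 0 0 - x0 0 0) * v 0 0 +
  ((x 0 1 - x0 0 1) * v 0 1 + (x 0 1 - x0 0 1) * v 0 1) +
  ((x 0 2 - x0 0 2) * v 0 2 + (x 0 2 - x0 0 2) * v 0 2)).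
ring.
Qed.

Let is_diff_phi (t : R) : is_diff t phi (fun u => u * dphi t).
Proof.
have [dp pv] := phi_derive t; apply: DiffDef; first exact/derivable1_diffP.
by rewrite deriv1E// derive1E pv.
Qed.

Let k i z := phi (s z) * y i z.

Let is_diff_k x i : is_diff x (k i)
  (fun v => phi (s x) * v 0 i + 2 * dphi (s x) * dot (x - x0) v * y i x).
Proof.
have d1 : is_diff x (phi \o s) _ := is_diff_comp (is_diff_s x) (is_diff_phi (s x)).
have d2 : is_diff x ((phi \o s) * y i) _ := is_diffM d1 (is_diff_y x i).
apply: (is_diff_eq d2); apply/funext => v.
rewrite -[LHS]/(phi (s x) * v 0 i + y i x * (2 * dot (x - x0) v * dphi (s x))).
ring.
Qed.

Let fieldE : radial_field = (fun z => k 0 z *: delta_mx 0 0) +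
  (fun z => k 1 z *: delta_mx 0 1) + (fun z => k 2 z *: delta_mx 0 2).
Proof.
apply/funext => z.
rewrite -[RHS]/(k 0 z *: delta_mx 0 0 + k 1 z *: delta_mx 0 1 + k 2 z *: delta_mx 0 2).
by apply/rowP; apply: forall_I3; rewrite !mxE /k /y /s/=; ring.
Qed.

Let is_diff_field x : is_diff x radial_field (radial_diff x).
Proof.
rewrite fieldE.
apply: (is_diff_eq (is_diff_sum3 _ _ _
  (is_diff_k x 0) (is_diff_k x 1) (is_diff_k x 2))).
apply/funext => v; rewrite /radial_diff -/(s x).
pose c i := phi (s x) * v 0 i + 2 * dphi (s x) * dot (x - x0) v * y i x.
rewrite -[LHS]/(c 0 *: delta_mx 0 0 + c 1 *: delta_mx 0 1 + c 2 *: delta_mx 0 2) /c.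
move: (phi _) (dphi _) (dot _ _) => p q r.
by apply/rowP; apply: forall_I3; rewrite !mxE /y/=; ring.
Qed.

Lemma radial_field_differentiable x : differentiable radial_field x.
Proof. by have [] := is_diff_field x. Qed.

Lemma radial_field_diff x : 'd radial_field x = radial_diff x :> (_ -> _).
Proof. by have [] := is_diff_field x. Qed.

Let s_continuous : continuous s.
Proof. by move=> x; apply/differentiable_continuous; have [] := is_diff_s x. Qed.

Let phi_continuous : continuous phi.
Proof. by move=> t; apply/differentiable_continuous; have [] := is_diff_phi t. Qed.

Let y_continuous i : continuous (y i).
Proof. by move=> x; apply/differentiable_continuous; have [] := is_diff_y x i. Qed.

Lemma radial_field_jacobian_continuous : continuous (jacobian radial_field).
Proof.
have -> : jacobian radial_field = (fun x => \matrix_(i, j)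
    (phi (s x) * (i == j)%:R + 2 * dphi (s x) * y i x * y j x)).
  apply/funext => x; apply/matrixP => i j.
  rewrite !mxE radial_field_diff /radial_diff !mxE /=.
  congr (_ * _%:R + _); first by rewrite eq_sym.
  congr (_ * _ * _).
  by rewrite dotE !mxE /=; move: i; apply: forall_I3; rewrite /y /=; ring.
move=> x; apply: (@cvg_mx _ (nbhs x) (nbhs_filter x)) => i j.
under eq_fun do rewrite mxE.
rewrite mxE.
have cphi : phi (s z) @[z --> x] --> phi (s x).
  exact: (@continuous_comp _ _ _ s phi x (@s_continuous x) (@phi_continuous _)).
have cdphi : dphi (s z) @[z --> x] --> dphi (s x).
  exact: (@continuous_comp _ _ _ s dphi x (@s_continuous x) (@dphi_cont _)).
apply: cvgD; first by apply: cvgM => //; exact: cvg_cst.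
do 2 (apply: cvgM; last exact: y_continuous).
by apply: cvgM => //; exact: cvg_cst.
Qed.

Lemma coord_le_enorm x i : `|x 0 i| <= enorm x.
Proof.
rewrite -sqrtr_sqr ler_wsqrtr// dotE.
have H0 := sqr_ge0 (x 0 0); have H1 := sqr_ge0 (x 0 1).
have H2 := sqr_ge0 (x 0 2).
by move: i; apply: forall_I3; lra.
Qed.

Lemma closed_eball r : closed (eball x0 r).
Proof.
have [r0|r0] := ltP r 0.
  have -> : eball x0 r = set0.
    by apply/seteqP; split => x //= /(le_trans (enorm_ge0 _)); rewrite leNgt r0.
  exact: closed0.
have -> : eball x0 r = s @^-1` [set t | t <= r ^+ 2].
  by apply/seteqP; split => x /=;
    rewrite /s -sqr_enorm ler_sqr// nnegrE ?enorm_ge0.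
by apply: preimage_closed; [move=> x _; exact: s_continuous|exact: closed_le].
Qed.

(** Boundedness refers to the sup norm, which the Euclidean norm dominates. *)
Lemma eball_compact r : compact (eball x0 r).
Proof.
apply: bounded_closed_compact; last exact: closed_eball.
exists (r + `|x0|); split; first exact: num_real.
move=> K rK x /= xr; rewrite (le_trans _ (ltW rK))//.
rewrite -(subrK x0 x) (le_trans (ler_normD _ _))// lerD2r (le_trans _ xr)//.
rewrite [leLHS]/Num.Def.normr/= mx_normrE (bigmax_le _ (enorm_ge0 _))//=.
by move=> [i j] _ /=; rewrite (ord1 i); exact: coord_le_enorm.
Qed.

Lemma radial_field_C1c (K : R) : (forall t, K <= t -> phi t = 0) ->
  C1c radial_field.
Proof.
move=> phiK; split.
- exact: radial_field_differentiable.
- exact: radial_field_jacobian_continuous.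
apply: (subclosed_compact _ (@eball_compact (Num.sqrt `|K|))).
  exact: closed_closure.
have /closure_id -> := @closed_eball (Num.sqrt `|K|).
apply: closureS => x /= X0; apply: ler_wsqrtr; rewrite leNgt.
apply: contra X0 => /ltW/(le_trans (ler_norm _))/phiK.
by rewrite /radial_field => ->; rewrite scale0r.
Qed.

(** The derivative of the profile meets only the tangential part of [x - x0], of squared length
    [s - N^2]. For the profile [1/t - 1/b] this gives [-2/b + 2 (N/s)^2]. *)
Lemma radial_field_tangential_div (xi : 'M[R]_3) x : Go_set xi ->
  tangential_div (plane xi) radial_field x =
  2 * phi (dot (x - x0) (x - x0)) + 2 * dphi (dot (x - x0) (x - x0)) *
    (dot (x - x0) (x - x0) - dot (x - x0) (star xi) ^+ 2).
Proof.
move=> Gxi; rewrite /tangential_div.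
case: xgetP => [e _ eP|/(_ _)]; last first.
  by have [e eP] := orthonormal_plane_exists Gxi => /(_ e).
rewrite !radial_field_diff /radial_diff -(orthonormal_plane_parseval _ Gxi eP).
case: eP => e11 e22 _ _; rewrite !dotDr !dotZr e11 e22 !(dotC (x - x0)); ring.
Qed.

End radial_fields.

(** * C^1 approximations of the truncated profile *)

Section cutoff.
Context (R : realType).
Implicit Types (a b t e : R).

Definition possq t := Num.max 0 t ^+ 2.

Lemma possq_is_derive t : is_derive t 1 possq (2 * Num.max 0 t).
Proof.
suff : h^-1 *: ((possq \o shift t) (h *: 1) - possq t) @[h --> 0^'] --> 2 * Num.max 0 t.
  move=> H; apply: DeriveDef; first exact: cvgP H.
  exact: cvg_lim H.
apply/cvgrPdist_le => e e0; near=> h.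
have h0 : h != 0 by near: h; exact: nbhs_dnbhs_neq.
have he : `|h| <= e.
  by near: h; apply: dnbhs0_le.
apply: le_trans he; rewrite /= [h *: 1]mulr1 -[_ *: _]/(_ * _).
set D := _ - possq t.
(* It remains to bound the first-order Taylor remainder by [h^2], by cases on the signs of [t] and
   [h + t]. *)
have -> : 2 * Num.max 0 t - h^-1 * D = h^-1 * (2 * Num.max 0 t * h - D) by field.
rewrite normrM normfV ler_pdivrMl ?normr_gt0// -expr2 real_normK ?num_real//.
rewrite ler_norml /D /possq.
have := sqr_ge0 (h + t); have := sqr_ge0 h; have := sqr_ge0 t.
case: (leP 0 t) => t0; case: (leP 0 (h + t)) => th *; apply/andP; split; nra.
Unshelve. all: by end_near. Qed.

(** A C^1 substitute for [max 0 t]: its derivative rises linearly from 0 to 1 on [[0, e]], and for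
    [t >= e] it equals [t - e / 2]. *)
Definition ramp e t := (2 * e)^-1 * (possq t - possq (t - e)).

Definition dramp e t := e^-1 * (Num.max 0 t - Num.max 0 (t - e)).

Lemma ramp_is_derive e t : e != 0 -> is_derive t 1 (ramp e) (dramp e t).
Proof.
move=> e0.
have d1 := possq_is_derive t; have d2 := possq_is_derive (t - e).
have d3 : is_derive t 1 (fun u => u - e) 1.
  by apply: is_derive_eq; rewrite subr0.
have d4 : is_derive t 1 (possq \o (fun u => u - e)) (2 * Num.max 0 (t - e)).
  by apply: is_derive_eq; rewrite mulr1.
rewrite (_ : ramp e = (2 * e)^-1 *: (possq - (possq \o (fun u => u - e))))//.
by apply: is_derive_eq; rewrite /dramp -[LHS]/(_ * (_ - _)); field.
Qed.


Lemma max0_continuous : continuous (fun t : R => Num.max 0 t).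
Proof.
move=> t; apply: continuous_max; [exact: cst_continuous|exact: cvg_id].
Qed.

Lemma dramp_continuous e : continuous (dramp e).
Proof.
move=> t; apply: cvgM; first exact: cvg_cst.
apply: cvgB; first exact: max0_continuous.
apply: (@continuous_comp _ _ _ (fun u => u - e) (fun u => Num.max 0 u)).
  by apply: cvgB; [exact: cvg_id|exact: cvg_cst].
exact: max0_continuous.
Qed.

Lemma ramp_ge0 e t : 0 < e -> 0 <= ramp e t.
Proof.
move=> e0; have tet : Num.max 0 (t - e) <= Num.max 0 t.
  by rewrite ge_max !le_max !lexx/= gerBl (ltW e0) orbT.
rewrite mulr_ge0 ?invr_ge0 ?mulr_ge0 ?(ltW e0)// subr_ge0.
by rewrite ler_sqr// nnegrE le_max lexx.
Qed.

Lemma ramp_eq0 e t : 0 <= e -> t <= 0 -> ramp e t = 0.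
Proof.
move=> e0 t0; rewrite /ramp /possq !(max_l _) ?subrr ?mulr0//; lra.
Qed.

Lemma ramp_linear e t : 0 < e -> e <= t -> ramp e t = t - e / 2.
Proof.
move=> e0 et; rewrite /ramp /possq !max_r; [|lra|lra].
by field; rewrite gt_eqF.
Qed.

Lemma dramp_eq0 e t : 0 <= e -> t <= 0 -> dramp e t = 0.
Proof.
move=> e0 t0; rewrite /dramp !(max_l _) ?subrr ?mulr0//; lra.
Qed.

Lemma dramp_eq1 e t : 0 < e -> e <= t -> dramp e t = 1.
Proof.
move=> e0 et; rewrite /dramp !max_r; [|lra|lra].
by field; rewrite gt_eqF.
Qed.

Lemma dramp_ge0_le1 e t : 0 < e -> 0 <= dramp e t <= 1.
Proof.
move=> e0; rewrite /dramp ler_pdivlMl// mulr0 ler_pdivrMl// mulr1.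
by case: (leP 0 t) => t0; case: (leP 0 (t - e)) => te; apply/andP; split; lra.
Qed.

(* [softmax e a] is a C^1 approximation of [Num.max a], from below. *)
Definition softmax e a t := a + ramp e (t - a).

Lemma softmax_ge e a t : 0 < e -> a <= softmax e a t.
Proof. by move=> e0; rewrite lerDl ramp_ge0. Qed.

Definition cutoff e a b t := (softmax e a t)^-1 - (softmax e b t)^-1.

Definition dcutoff e a b t :=
  dramp e (t - b) / softmax e b t ^+ 2 - dramp e (t - a) / softmax e a t ^+ 2.

Lemma softmax_is_derive e a t : 0 < e ->
  is_derive t 1 (softmax e a) (dramp e (t - a)).
Proof.
move=> e0.
have d1 := ramp_is_derive (t - a) (lt0r_neq0 e0).
have d3 : is_derive t 1 (fun u => u - a) 1.
  by apply: is_derive_eq; rewrite subr0.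
have d4 : is_derive t 1 (ramp e \o (fun u => u - a)) (dramp e (t - a)).
  by apply: is_derive_eq; rewrite mulr1.
rewrite (_ : softmax e a = cst a + (ramp e \o (fun u => u - a)))//.
by apply: is_derive_eq; rewrite add0r.
Qed.

Lemma softmaxV_is_derive e a t : 0 < e -> 0 < a ->
  is_derive t 1 (fun u => (softmax e a u)^-1)
    (- (dramp e (t - a) / softmax e a t ^+ 2)).
Proof.
move=> e0 a0; have d := softmax_is_derive a t e0.
have n0 : softmax e a t != 0 by rewrite gt_eqF// (lt_le_trans a0)// softmax_ge.
apply: (is_derive_eq (is_deriveV n0 d)).
by rewrite -[LHS]/(- _ * _) -exprVn mulNr mulrC.
Qed.

Lemma cutoff_is_derive e a b t : 0 < e -> 0 < a -> 0 < b ->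
  is_derive t 1 (cutoff e a b) (dcutoff e a b t).
Proof.
move=> e0 a0 b0.
have d1 := softmaxV_is_derive t e0 a0; have d2 := softmaxV_is_derive t e0 b0.
by apply: (is_derive_eq (is_deriveB d1 d2)); rewrite opprK addrC.
Qed.

Lemma softmax_continuous e a : 0 < e -> continuous (softmax e a).
Proof.
move=> e0 t; have [dt _] := softmax_is_derive a t e0.
exact/differentiable_continuous/derivable1_diffP.
Qed.

Lemma dcutoff_continuous e a b : 0 < e -> 0 < a -> 0 < b ->
  continuous (dcutoff e a b).
Proof.
move=> e0 a0 b0 t.
have H c : 0 < c -> (fun t => dramp e (t - c) / softmax e c t ^+ 2) u @[u --> t] -->
    dramp e (t - c) / softmax e c t ^+ 2.
  move=> c0; apply: cvgM.
    apply: (@continuous_comp _ _ _ (fun u => u - c) (dramp e)).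
      by apply: cvgB; [exact: cvg_id|exact: cvg_cst].
    exact: dramp_continuous.
  have n0 : softmax e c t != 0 by rewrite gt_eqF// (lt_le_trans c0)// softmax_ge.
  by apply: cvgV; [rewrite sqrf_eq0|apply: cvgM; exact: softmax_continuous].
by apply: cvgB; exact: H.
Qed.

(** Beyond their transitions both softmaxes equal [t - e / 2], with the same loss. The exact
    cancellation gives the test field compact support. *)
Lemma cutoff_eq0 e a b t : 0 < e -> a < b -> b + e <= t -> cutoff e a b t = 0.
Proof.
move=> e0 ab bt; rewrite /cutoff /softmax !ramp_linear//; try lra.
have -> : a + (t - a - e / 2) = b + (t - b - e / 2) by ring.
by rewrite subrr.
Qed.

Lemma dcutoff_eq0 e a b t : 0 < e -> a < b -> b + e <= t -> dcutoff e a b t = 0.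
Proof.
move=> e0 ab bt; rewrite /dcutoff /softmax !ramp_linear ?dramp_eq1//; try lra.
have -> : a + (t - a - e / 2) = b + (t - b - e / 2) by ring.
by rewrite subrr.
Qed.

(** This bound and the next are uniform in [e], for dominated convergence. *)
Lemma cutoff_norm_le e a b t : 0 < e -> 0 < a -> a < b -> `|cutoff e a b t| <= a^-1.
Proof.
move=> e0 a0 ab; have b0 := lt_trans a0 ab.
have sa := softmax_ge a t e0; have sb := softmax_ge b t e0.
have sa0 := lt_le_trans a0 sa; have sb0 := lt_le_trans b0 sb.
have : (softmax e a t)^-1 <= a^-1 by rewrite lef_pV2.
have : (softmax e b t)^-1 <= b^-1 by rewrite lef_pV2.
have : b^-1 < a^-1 by rewrite ltf_pV2.
have : 0 < (softmax e a t)^-1 by rewrite invr_gt0.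
have : 0 < (softmax e b t)^-1 by rewrite invr_gt0.
by rewrite /cutoff ler_norml => *; apply/andP; split; lra.
Qed.

Lemma dcutoff_norm_le e a b t : 0 < e -> 0 < a -> a < b ->
  `|dcutoff e a b t| <= a^-1 ^+ 2.
Proof.
move=> e0 a0 ab; have b0 := lt_trans a0 ab.
have H c : 0 < c -> 0 <= dramp e (t - c) / softmax e c t ^+ 2 <= c^-1 ^+ 2.
  move=> c0; have /andP[d0 d1] := dramp_ge0_le1 (t - c) e0.
  have sc := softmax_ge c t e0; have sc0 := lt_le_trans c0 sc.
  rewrite divr_ge0 ?sqr_ge0//= -exprVn -[leRHS]mul1r ler_pM ?sqr_ge0//.
  by rewrite ler_sqr ?nnegrE ?invr_ge0 ?(ltW sc0) ?(ltW c0)// lef_pV2.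
have /andP[Ha0 Ha] := H a a0; have /andP[Hb0 Hb] := H b b0.
have : b^-1 ^+ 2 <= a^-1 ^+ 2.
  by rewrite ler_sqr ?nnegrE ?invr_ge0 ?(ltW a0) ?(ltW b0)// lef_pV2 ?ltW.
by rewrite /dcutoff ler_norml => ?; apply/andP; split; lra.
Qed.

Let d (n : nat) : R := n.+1%:R^-1.

Lemma softmax_cvg a t : softmax (d n) a t @[n --> \oo] --> Num.max a t.
Proof.
case: (leP t a) => ta.
  apply: cvg_near_cst; apply: nearW => n.
  by rewrite /softmax ramp_eq0 ?addr0// ?invr_ge0// subr_le0.
have H : \forall n \near \oo, t - 2^-1 * d n = softmax (d n) a t.
  have k0 : 0 < t - a by rewrite subr_gt0.
  near=> n; have dn : d n < t - a.
    by near: n; exact: near_infty_natSinv_lt (PosNum k0).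
  rewrite /softmax ramp_linear ?(ltW dn) ?invr_gt0//.
  by move: (d n) => w; lra.
have L : t - 2^-1 * d n @[n --> \oo] --> t - 2^-1 * 0.
  apply: cvgB; first exact: cvg_cst.
  by apply: cvgM; [exact: cvg_cst|exact: cvg_harmonic].
by rewrite mulr0 subr0 in L; exact: cvg_trans (near_eq_cvg H) L.
Unshelve. all: by end_near. Qed.

(** Every [dramp e] vanishes at 0, so the limit exists at each [t] and closed balls appear in the
    limit identity. Spheres of positive measure need no separate treatment. *)
Lemma dramp_cvg t : dramp (d n) t @[n --> \oo] --> (if t <= 0 then 0 else 1 : R).
Proof.
apply: cvg_near_cst; case: (leP t 0) => t0.
  by apply: nearW => n; rewrite dramp_eq0 ?invr_ge0.
near=> n; have dn : d n < t.
  by near: n; exact: near_infty_natSinv_lt (PosNum t0).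
by rewrite dramp_eq1 ?invr_gt0// ltW.
Unshelve. all: by end_near. Qed.

Lemma cutoff_cvg a b t : 0 < a -> a < b -> cutoff (d n) a b t @[n --> \oo] -->
  (if t <= a then a^-1 - b^-1 else if t <= b then t^-1 - b^-1 else 0).
Proof.
move=> a0 ab; have b0 := lt_trans a0 ab.
have H c : 0 < c -> (softmax (d n) c t)^-1 @[n --> \oo] --> (Num.max c t)^-1.
  move=> c0; apply: cvgV; last exact: softmax_cvg.
  by rewrite gt_eqF// lt_max c0.
rewrite (_ : (if _ then _ else _) = (Num.max a t)^-1 - (Num.max b t)^-1).
  exact: cvgB (H a a0) (H b b0).
case: (leP t a) => ta; first by rewrite max_l// (le_trans ta (ltW ab)).
by case: (leP t b) => tb//; rewrite subrr.
Qed.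

Lemma dcutoff_cvg a b t : 0 < a -> a < b -> dcutoff (d n) a b t @[n --> \oo] -->
  (if t <= a then 0 else if t <= b then - t^-1 ^+ 2 else 0).
Proof.
move=> a0 ab; have b0 := lt_trans a0 ab.
have H c : 0 < c -> dramp (d n) (t - c) / softmax (d n) c t ^+ 2 @[n --> \oo] -->
    (if t - c <= 0 then 0 else 1 : R) / Num.max c t ^+ 2.
  move=> c0; apply: cvgM; first exact: dramp_cvg.
  apply: cvgV; first by rewrite sqrf_eq0 gt_eqF// lt_max c0.
  by apply: cvgM; exact: softmax_cvg.
rewrite (_ : (if t <= a then _ else _) =
    (if t - b <= 0 then 0 else 1 : R) / Num.max b t ^+ 2 -
    (if t - a <= 0 then 0 else 1 : R) / Num.max a t ^+ 2).
  exact: cvgB (H b b0) (H a a0).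
rewrite !subr_le0; case: (leP t a) => ta.
  by rewrite (le_trans ta (ltW ab)) !mul0r subrr.
case: (leP t b) => tb; last by rewrite subrr.
by rewrite mul0r sub0r mul1r exprVn.
Qed.

End cutoff.

(** * The first variation tested with truncated radial fields *)

Section measurability.
Context (R : realType).

Lemma borel_measurable_fun d (T : topMeasurableType d) (f : T -> R) :
  (forall U : set T, open U -> measurable U) -> continuous f ->
  measurable_fun setT f.
Proof.
move=> oU /continuousP cf; apply: (measurability _ (RGenOpens.measurableE R)).
move=> _ [_ [a [b ->] <-]]; rewrite setTI; apply/oU/cf/interval_open => //.
Qed.

(** Scalar products only need measurable coordinates, and this form is stable under differences and
    scaling by the corresponding real lemmas. *)
Definition coord_measurable d (T : measurableType d) (f : T -> 'rV[R]_3) :=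
  forall i, measurable_fun setT (fun x => f x 0 i).

Lemma measurable_coord_measurable d (T : measurableType d)
  (f : T -> 'rV[R]_3) : measurable_fun setT f -> coord_measurable f.
Proof.
move=> mf i.
have mc : measurable_fun setT (fun x : 'rV[R]_3 => x 0 i).
  apply: borel_measurable_fun; first by move=> U oU; exact: sub_sigma_algebra.
  exact: coord_continuous.
exact: (measurableT_comp mc mf).
Qed.

Lemma coord_measurable_dot d (T : measurableType d) (f g : T -> 'rV[R]_3) :
  coord_measurable f -> coord_measurable g ->
  measurable_fun setT (fun x => dot (f x) (g x)).
Proof.
move=> mf mg; under eq_fun do rewrite dotE.
by do 2?apply: measurable_funD; apply: measurable_funM.
Qed.

Lemma coord_measurableB d (T : measurableType d) (f g : T -> 'rV[R]_3) :
  coord_measurable f -> coord_measurable g ->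
  coord_measurable (fun x => f x - g x).
Proof.
move=> mf mg i; under eq_fun do rewrite !mxE.
exact: measurable_funB.
Qed.

Lemma coord_measurable_cst d (T : measurableType d) (x : 'rV[R]_3) :
  coord_measurable (fun _ : T => x).
Proof. by move=> i; exact: measurable_cst. Qed.

Lemma coord_measurableZ d (T : measurableType d) (f : T -> 'rV[R]_3)
    (k : T -> R) : measurable_fun setT k -> coord_measurable f ->
  coord_measurable (fun x => k x *: f x).
Proof.
move=> mk mf i; under eq_fun do rewrite !mxE.
exact: measurable_funM.
Qed.

Lemma coord_measurable_id : coord_measurable (fun x : 'rV[R]_3 => x).
Proof. exact/measurable_coord_measurable/measurable_id. Qed.

Lemma coord_measurable_comp_fst (f : 'rV[R]_3 -> 'rV[R]_3) :
  coord_measurable f ->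
  coord_measurable (fun z : 'rV[R]_3 * Go R => f z.1).
Proof. by move=> mf i; exact: (measurableT_comp (mf i) measurable_fst). Qed.

Lemma coord_measurable_star :
  coord_measurable (fun z : 'rV[R]_3 * Go R => star (Go_val z.2)).
Proof.
move=> i; under eq_fun do rewrite mxE.
have mc : measurable_fun setT (fun xi : Go R => Go_val xi (i + 1) (i + 2)).
  apply: borel_measurable_fun; first by move=> U oU; exact: sub_sigma_algebra.
  move=> xi; apply: (@continuous_comp _ _ _ (@Go_val R)
    (fun M : 'M[R]_3 => M (i + 1) (i + 2))).
    exact: initial_continuous.
  exact: coord_continuous.
exact: (measurableT_comp mc measurable_snd).
Qed.

Lemma measurable_dot_sub (x0 : 'rV[R]_3) :
  measurable_fun setT (fun x : 'rV[R]_3 => dot (x - x0) (x - x0)).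
Proof.
have m : coord_measurable (fun x : 'rV[R]_3 => x - x0).
  exact: coord_measurableB coord_measurable_id (@coord_measurable_cst _ _ _).
exact: coord_measurable_dot.
Qed.

End measurability.

(** * Passage to the limit in the first variation identity *)

Section first_variation_identity.
Context (R : realType).
Variables (V : {measure set ('rV[R]_3 * Go R) -> \bar R})
  (beta : {measure set 'rV[R]_3 -> \bar R})
  (eta H : 'rV[R]_3 -> 'rV[R]_3) (c0 : R) (x0 : 'rV[R]_3).

Let s (z : 'rV[R]_3 * Go R) := dot (z.1 - x0) (z.1 - x0).
Let N (z : 'rV[R]_3 * Go R) := dot (z.1 - x0) (star (Go_val z.2)).
Let h (z : 'rV[R]_3 * Go R) := dot (H z.1) (star (Go_val z.2)).
Let P (z : 'rV[R]_3 * Go R) := dot (z.1 - x0) (H z.1).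
Let K z := H z.1 - c0 *: star (Go_val z.2).

Hypotheses (mH : measurable_fun setT H) (meta : measurable_fun setT eta)
  (eta1 : {ae beta, forall x, enorm (eta x) = 1}).
Hypothesis fvE : forall X, C1c X ->
  first_variation V X =
    - (\int[weight_measure V]_x dot (X x) (H x)) + \int[beta]_x dot (X x) (eta x).
Hypothesis Hperp : {ae V, forall z, wedge (H z.1) (star (Go_val z.2)) = 0}.
Hypothesis K2_int : V.-integrable setT (EFin \o (fun z => dot (K z) (K z))).
Hypothesis fin_V : forall b, (V [set z | (s z <= b)%R] < +oo)%E.
Hypothesis fin_beta :
  forall b, (beta [set x | (dot (x - x0) (x - x0) <= b)%R] < +oo)%E.

Let cm_sub : coord_measurable (fun x : 'rV[R]_3 => x - x0).
Proof.
exact: coord_measurableB (@coord_measurable_id _) (@coord_measurable_cst _ _ _ _).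
Qed.
Let cm_sub1 : coord_measurable (fun z : 'rV[R]_3 * Go R => z.1 - x0).
Proof. exact: (@coord_measurable_comp_fst _ (fun x => x - x0)). Qed.
Let cm_H : coord_measurable H.
Proof. exact: measurable_coord_measurable. Qed.
Let cm_H1 : coord_measurable (fun z : 'rV[R]_3 * Go R => H z.1).
Proof. exact: coord_measurable_comp_fst. Qed.
Let cm_eta : coord_measurable eta.
Proof. exact: measurable_coord_measurable. Qed.
Let cm_star := @coord_measurable_star R.

Lemma measurable_sqdist : measurable_fun setT s.
Proof. exact: coord_measurable_dot. Qed.

Lemma measurable_normal : measurable_fun setT N.
Proof. exact: coord_measurable_dot. Qed.

Lemma measurable_curvature : measurable_fun setT h.
Proof. exact: coord_measurable_dot. Qed.

Let mP : measurable_fun setT P.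
Proof. exact: coord_measurable_dot. Qed.

Lemma normal_le_sqdist z : N z ^+ 2 <= s z.
Proof.
apply: le_trans (dot_cauchy_schwarz _ _) _.
by rewrite Go_set_dot_star ?mulr1//; exact: Go_valP.
Qed.

(** [h - c0] is the component of [K] along the unit vector [star xi]. *)
Lemma curvature_integrable :
  V.-integrable setT (EFin \o (fun z => (h z - c0) ^+ 2)).
Proof.
apply: rintegrable_le K2_int _.
  by apply: measurable_funX; apply: measurable_funB => //; exact: measurable_curvature.
move=> z; rewrite ger0_norm ?sqr_ge0//.
have n1 := Go_set_dot_star (Go_valP z.2).
rewrite (_ : h z - c0 = dot (K z) (star (Go_val z.2))).
  by apply: le_trans (dot_cauchy_schwarz _ _) _; rewrite n1 mulr1.
by rewrite /K dotBl dotZl n1 mulr1.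
Qed.

Let P_ae : {ae V, forall z, P z = N z * h z}.
Proof.
apply: filterS Hperp => z /matrixP W.
have n1 := Go_set_dot_star (Go_valP z.2).
rewrite -[P z]mulr1 -n1 /P /N /h; move: (star _) (H z.1) (z.1 - x0) W => n u y W.
have E i j : u 0 i * n 0 j = u 0 j * n 0 i.
  by have := W i j; rewrite !mxE => /eqP; rewrite subr_eq0 => /eqP.
have E1 := E 0 1; have E2 := E 0 2; have E3 := E 1 2.
rewrite !dotE; move: E1 E2 E3.
move: (u 0 0) (u 0 1) (u 0 2) (n 0 0) (n 0 1) (n 0 2) (y 0 0) (y 0 1) (y 0 2).
move=> u0 u1 u2 n0 n1' n2 y0 y1 y2 E1 E2 E3.
(* The Binet-Cauchy identity; the last three products contain the coordinates of [u /\ n], which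
   vanish. *)
transitivity ((y0 * n0 + y1 * n1' + y2 * n2) * (u0 * n0 + u1 * n1' + u2 * n2)
  + (u0 * n1' - u1 * n0) * (y0 * n1' - y1 * n0)
  + (u0 * n2 - u2 * n0) * (y0 * n2 - y2 * n0)
  + (u1 * n2 - u2 * n1') * (y1 * n2 - y2 * n1')); first by ring.
by rewrite E1 E2 E3 !subrr !mul0r !addr0.
Qed.

Definition cutoff_limit (a b t : R) :=
  if t <= a then a^-1 - b^-1 else if t <= b then t^-1 - b^-1 else 0.

Let w (a b t : R) := if t <= a then 0 else if t <= b then - t^-1 ^+ 2 else 0.

Let cut_meas d (T : measurableType d) (t : T -> R) (a b : R) :
  measurable_fun setT t -> measurable_fun setT (fun x => cutoff_limit a b (t x)).
Proof.
move=> mt; apply: measurable_fun_ifT; [exact: measurable_fun_ler|by []|].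
apply: measurable_fun_ifT => //; first exact: measurable_fun_ler.
by apply: measurable_funB => //; exact: measurable_funV.
Qed.

Let w_meas (a b : R) : measurable_fun setT (fun z => w a b (s z)).
Proof.
have ms := measurable_sqdist.
apply: measurable_fun_ifT; [exact: measurable_fun_ler|by []|].
apply: measurable_fun_ifT => //; first exact: measurable_fun_ler.
by apply: measurableT_comp => //; apply: measurable_funX; exact: measurable_funV.
Qed.

Let dl (n : nat) : R := n.+1%:R^-1.
Let dl_gt0 n : 0 < dl n. Proof. by rewrite invr_gt0. Qed.
Let dl_le1 n : dl n <= 1. Proof. by rewrite invf_le1// ler1n. Qed.

Let comp_meas d (T : measurableType d) (t : T -> R) (f : R -> R) :
  measurable_fun setT t -> continuous f -> measurable_fun setT (fun x => f (t x)).
Proof.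
by move=> mt cf; apply: (measurableT_comp _ mt); exact: continuous_measurable_fun.
Qed.

Let cutoff_cont (e a b : R) : 0 < e -> 0 < a -> 0 < b -> continuous (cutoff e a b).
Proof.
move=> e0 a0 b0 t; have [dt _] := cutoff_is_derive t e0 a0 b0.
exact/differentiable_continuous/derivable1_diffP.
Qed.

Lemma div_term_cvg (a b : R) : 0 < a -> a < b ->
  V.-integrable setT (EFin \o (fun z =>
     2 * cutoff_limit a b (s z) + 2 * w a b (s z) * (s z - N z ^+ 2))) /\
  \int[V]_z (2 * cutoff (dl n) a b (s z) +
    2 * dcutoff (dl n) a b (s z) * (s z - N z ^+ 2)) @[n --> \oo] -->
  \int[V]_z (2 * cutoff_limit a b (s z) + 2 * w a b (s z) * (s z - N z ^+ 2)).
Proof.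
move=> a0 ab; have b0 := lt_trans a0 ab.
have ms := measurable_sqdist; have mN := measurable_normal.
(* As [dl n <= 1], every cutoff is supported in [s <= b + 1], where [s - N^2 <= b + 1]. *)
pose C := 2 * a^-1 + 2 * a^-1 ^+ 2 * (b + 1).
apply: (cvg_Rintegral_dominated (g := fun z => C * sublevel s (b + 1) z)).
- move=> n; apply: measurable_funD; first by apply: measurable_funM => //;
    apply: comp_meas => //; exact: cutoff_cont.
  apply: measurable_funM; last by apply: measurable_funB => //; exact: measurable_funX.
  by apply: measurable_funM => //; apply: comp_meas => //; exact: dcutoff_continuous.
- apply: measurable_funD; first by apply: measurable_funM => //; exact: cut_meas.
  apply: measurable_funM; last by apply: measurable_funB => //; exact: measurable_funX.
  exact: measurable_funM.
- apply: aeW => z; apply: cvgD.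
    by apply: cvgM; [exact: cvg_cst|exact: cutoff_cvg].
  apply: cvgM; last exact: cvg_cst.
  by apply: cvgM; [exact: cvg_cst|exact: dcutoff_cvg].
- by apply: rintegrableZl; apply: integrable_sublevel.
- apply: aeW => z n; rewrite /sublevel; case: ifPn => sb; last first.
    rewrite -ltNge in sb.
    have bs : b + dl n <= s z by rewrite (le_trans _ (ltW sb))// lerD2l.
    by rewrite cutoff_eq0// dcutoff_eq0// !(mulr0, mul0r) addr0 normr0.
  have ia : 0 < a^-1 by rewrite invr_gt0.
  have := cutoff_norm_le (s z) (dl_gt0 n) a0 ab.
  have := dcutoff_norm_le (s z) (dl_gt0 n) a0 ab.
  have N0 := sqr_ge0 (N z); have Ns := normal_le_sqdist z.
  have sN0 : 0 <= s z - N z ^+ 2 by rewrite subr_ge0.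
  move=> D1 D2; apply: (le_trans (ler_normD _ _)); rewrite mulr1 !normrM.
  rewrite (ger0_norm sN0) (ger0_norm (ler0n R 2)); rewrite /C lerD//.
    by rewrite ler_pM2l.
  rewrite ler_pM ?mulr_ge0 ?subr_ge0//; last lra.
  by rewrite ler_pM2l.
Qed.

Let H2_le z : dot (H z.1) (H z.1) <= 2 * dot (K z) (K z) + 2 * c0 ^+ 2.
Proof.
have n1 := Go_set_dot_star (Go_valP z.2).
(* This square is exactly the difference of the two sides. *)
have := dot_ge0 (H z.1 - (2 * c0) *: star (Go_val z.2)).
rewrite /K !dotBl ![dot _ (_ - _)]dotC !dotBl !dotZl ![dot _ (_ *: _)]dotC !dotZl.
rewrite n1 [dot (star _) (H _)]dotC; lra.
Qed.

Let dot_le_half (u v : 'rV[R]_3) : `|dot u v| <= (dot u u + dot v v) / 2.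
Proof.
have := dot_ge0 (u + v); have := dot_ge0 (u - v).
rewrite ![dot _ (_ - _)]dotC !dotBl ![dot _ (_ - _)]dotC !dotBl !dotDl.
rewrite !dotDr [dot v u]dotC => *; rewrite ler_norml; apply/andP; split; lra.
Qed.

(** Dominates the curvature term for all [n]: [|P| <= (s + |H|^2) / 2], and [H2_le] trades [H] for
    the square integrable [K]. *)
Let PG (a b : R) z :=
  a^-1 * (((b + 1) / 2 + c0 ^+ 2) * sublevel s (b + 1) z + dot (K z) (K z)).

Let PG_int (a b : R) : V.-integrable setT (EFin \o PG a b).
Proof.
apply: rintegrableZl; apply: rintegrableD => //.
by apply: rintegrableZl; apply: integrable_sublevel => //; exact: measurable_sqdist.
Qed.

Let PG_dom (a b : R) n z : 0 < a -> a < b ->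
  `|cutoff (dl n) a b (s z) * P z| <= PG a b z.
Proof.
move=> a0 ab; have b0 := lt_trans a0 ab.
have ia : 0 < a^-1 by rewrite invr_gt0.
have K0 := dot_ge0 (K z).
rewrite /PG /sublevel; case: ifPn => sb; last first.
  rewrite -ltNge in sb.
  have bs : b + dl n <= s z by rewrite (le_trans _ (ltW sb))// lerD2l.
  by rewrite cutoff_eq0// mul0r normr0 mulr0 add0r mulr_ge0// ltW.
rewrite normrM ler_pM//; first exact: cutoff_norm_le.
apply: (le_trans (dot_le_half _ _)); rewrite -/(s z) mulr1.
by have := H2_le z; lra.
Qed.

Let cutoffP_meas (a b : R) n : 0 < a -> a < b ->
  measurable_fun setT (fun z => cutoff (dl n) a b (s z) * P z).
Proof.
move=> a0 ab; apply: measurable_funM => //.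
apply: comp_meas; first exact: measurable_sqdist.
exact: cutoff_cont (lt_trans a0 ab).
Qed.

Let curvature_term_cvg (a b : R) : 0 < a -> a < b ->
  V.-integrable setT (EFin \o (fun z => cutoff_limit a b (s z) * P z)) /\
  \int[V]_z (cutoff (dl n) a b (s z) * P z) @[n --> \oo] -->
  \int[V]_z (cutoff_limit a b (s z) * P z).
Proof.
move=> a0 ab; apply: (cvg_Rintegral_dominated (g := PG a b)) => //.
- by move=> n; exact: cutoffP_meas.
- by apply: measurable_funM => //; exact: cut_meas measurable_sqdist.
- apply: aeW => z; apply: cvgM; [exact: cutoff_cvg|exact: cvg_cst].
- by apply: aeW => z n; exact: PG_dom.
Qed.

Let boundary_term_cvg (a b : R) : 0 < a -> a < b ->
  beta.-integrable setT (EFin \o (fun x =>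
    cutoff_limit a b (dot (x - x0) (x - x0)) * dot (x - x0) (eta x))) /\
  \int[beta]_x (cutoff (dl n) a b (dot (x - x0) (x - x0)) * dot (x - x0) (eta x))
    @[n --> \oo] -->
  \int[beta]_x (cutoff_limit a b (dot (x - x0) (x - x0)) * dot (x - x0) (eta x)).
Proof.
move=> a0 ab; have b0 := lt_trans a0 ab.
pose t (x : 'rV[R]_3) := dot (x - x0) (x - x0).
have mt : measurable_fun setT t by exact: coord_measurable_dot.
have mQ : measurable_fun setT (fun x : 'rV[R]_3 => dot (x - x0) (eta x)).
  exact: coord_measurable_dot.
(* Bounds [(t + |eta|^2) / 2] where [t <= b + 1] and [|eta| = 1]; the latter makes the domination
   hold only almost everywhere. *)
pose C := (b + 2) / 2.
apply: (cvg_Rintegral_dominated (g := fun x => a^-1 * (C * sublevel t (b + 1) x))).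
- move=> n; apply: measurable_funM => //.
  by apply: (comp_meas mt); exact: cutoff_cont.
- by apply: measurable_funM => //; exact: (cut_meas _ _ mt).
- apply: aeW => z; apply: cvgM; [exact: cutoff_cvg|exact: cvg_cst].
- by do 2 apply: rintegrableZl; apply: integrable_sublevel.
- have ia : 0 < a^-1 by rewrite invr_gt0.
  apply: filterS eta1 => x ex n; rewrite /sublevel -/(t x).
  case: ifPn => sb; last first.
    rewrite -ltNge in sb.
    have bs : b + dl n <= t x by rewrite (le_trans _ (ltW sb))// lerD2l.
    by rewrite cutoff_eq0// mul0r normr0 !mulr0.
  rewrite normrM ler_pM//; first exact: cutoff_norm_le.
  apply: (le_trans (dot_le_half _ _)); rewrite -/(t x) mulr1 /C.
  by rewrite -(sqr_enorm (eta x)) ex; lra.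
Qed.

Lemma boundary_integrable (a b : R) : 0 < a -> a < b ->
  beta.-integrable setT (EFin \o (fun x =>
    cutoff_limit a b (dot (x - x0) (x - x0)) * dot (x - x0) (eta x))).
Proof. by move=> a0 ab; have [] := boundary_term_cvg a0 ab. Qed.

Let weight_integral (f : 'rV[R]_3 -> R) : measurable_fun setT f ->
  V.-integrable setT (EFin \o (fun z => f z.1)) ->
  \int[weight_measure V]_x f x = \int[V]_z f z.1.
Proof.
move=> mf fi; congr fine.
have mf' : measurable_fun setT (EFin \o f) by exact/measurable_EFinP.
by have := integral_pushforward measurable_fst mf' fi measurableT;
  rewrite preimage_setT.
Qed.

Lemma monotonicity_identity (a b : R) : 0 < a -> a < b ->
  \int[V]_z mono_integrand s N h a b z =
  \int[beta]_x (cutoff_limit a b (dot (x - x0) (x - x0)) * dot (x - x0) (eta x)).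
Proof.
move=> a0 ab; have b0 := lt_trans a0 ab.
have ms := measurable_sqdist; have mN := measurable_normal.
have mh := measurable_curvature.
have [iD cD] := div_term_cvg a0 ab.
have [iP cP] := curvature_term_cvg a0 ab.
have [iB cB] := boundary_term_cvg a0 ab.
(* The limiting field is only Lipschitz, so its identity comes from uniqueness of limits along the
   C^1 cutoffs. *)
have E : \int[V]_z (2 * cutoff_limit a b (s z) + 2 * w a b (s z) * (s z - N z ^+ 2)) =
    - (\int[V]_z (cutoff_limit a b (s z) * P z)) +
    \int[beta]_x (cutoff_limit a b (dot (x - x0) (x - x0)) * dot (x - x0) (eta x)).
  apply: (cvg_unique _ cD) => //.
  apply: cvg_trans (cvgD (cvgN cP) cB); apply: near_eq_cvg; apply: nearW => n.
  have e0 := dl_gt0 n.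
  have dphi (t : R) : is_derive t 1 (cutoff (dl n) a b) (dcutoff (dl n) a b t).
    exact: cutoff_is_derive.
  have cdphi : continuous (dcutoff (dl n) a b) by exact: dcutoff_continuous.
  have XC : C1c (radial_field x0 (cutoff (dl n) a b)).
    by apply: (radial_field_C1c x0 dphi cdphi (K := b + dl n)) => t; exact: cutoff_eq0.
  have := fvE XC; rewrite /first_variation.
  under eq_Rintegral do rewrite (radial_field_tangential_div x0 dphi _ (Go_valP _)).
  move=> ->; congr (- _ + _).
    rewrite -(@weight_integral (fun x =>
      cutoff (dl n) a b (dot (x - x0) (x - x0)) * dot (x - x0) (H x))).
    - by apply: eq_Rintegral => x _; rewrite dotZl.
    - apply: measurable_funM; last exact: coord_measurable_dot.
      by apply: (comp_meas (@measurable_dot_sub _ x0)); exact: cutoff_cont.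
    - apply: rintegrable_le (PG_int a b) _; first exact: cutoffP_meas.
      by move=> z; exact: PG_dom.
  by apply: eq_Rintegral => x _; rewrite dotZl.
rewrite (@Rintegral_ae_eq _ _ _ _ _ (fun z =>
  (2 * cutoff_limit a b (s z) + 2 * w a b (s z) * (s z - N z ^+ 2)) +
  cutoff_limit a b (s z) * P z)).
- by rewrite RintegralD// E addrAC addNr add0r.
- exact: measurable_mono_integrand.
- apply: measurable_funD; first exact: rintegrable_measurable iD.
  exact: rintegrable_measurable iP.
(* Perpendicularity of [H] enters here: with [P = N h] the divergence and curvature terms add up to
   [mono_integrand]. *)
apply: filterS P_ae => z ->.
rewrite /mono_integrand /cutoff_limit /w.
case: (leP (s z) a) => sa; first by ring.
case: (leP (s z) b) => sb; last by ring.
by field; rewrite !gt_eqF// (lt_trans a0 sa).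
Qed.

End first_variation_identity.

(** * The density bound *)

Section limsup.
Context (R : realType).
Local Open Scope ereal_scope.

Lemma limf_esup_pinfty_lt (f : R -> \bar R) (c : \bar R) :
  limf_esup f +oo%R < c -> \forall r \near +oo%R, f r < c.
Proof.
move=> /ereal_inf_lt[_ [A FA <-] Ac]; apply: filterS FA => r Ar.
by apply: le_lt_trans Ac; apply: ereal_sup_ubound; exists r.
Qed.

(** If [x] or [y] is [-oo], sufficiently negative [a] or [b] contradict the hypothesis, so only the
    finite case has content. *)
Lemma lee_add_of_lt (t k : R) (x y : \bar R) : x != +oo -> y != +oo ->
  (forall a b e : R, x < a%:E -> y < b%:E -> (0 < e)%R ->
    (t <= k + a + b + e)%R) ->
  t%:E <= k%:E + x + y.
Proof.
have o (a : R) : -oo < a%:E by exact: ltNyr.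
have l (a e : R) : (0 < e)%R -> a%:E < (a + e)%:E by rewrite lte_fin ltrDl.
case: x => [x||]// _; case: y => [y||]// _ H.
- apply/lee_addgt0Pr => e e0; rewrite -!EFinD lee_fin.
  have e3 : (0 < e / 3)%R by rewrite divr_gt0.
  have := H _ _ _ (l x _ e3) (l y _ e3) e3; lra.
- have := H _ _ _ (l x _ ltr01) (o (t - k - x - 3)%R) ltr01 => ?; exfalso; lra.
- have := H _ _ _ (o (t - k - y - 3)%R) (l y _ ltr01) ltr01 => ?; exfalso; lra.
- have := H _ _ _ (o 0%R) (o (t - k - 2)%R) ltr01 => ?; exfalso; lra.
Qed.

End limsup.

(** * Euclidean balls in terms of squared distances *)

Section euclidean_balls.
Context (R : realType).
Implicit Types (x : 'rV[R]_3) (r : R).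

Lemma eball_sqdist x r : 0 <= r ->
  eball x r = [set y | dot (y - x) (y - x) <= r ^+ 2].
Proof.
move=> r0; apply/seteqP; split => y /=;
  by rewrite -sqr_enorm ler_sqr ?nnegrE ?enorm_ge0.
Qed.

Lemma sqdist_sqrt x b : 0 <= b ->
  [set y | dot (y - x) (y - x) <= b] = eball x (Num.sqrt b).
Proof. by move=> b0; rewrite eball_sqdist ?sqrtr_ge0// sqr_sqrtr. Qed.

Lemma sqdist_lt0 x b : b < 0 -> [set y | dot (y - x) (y - x) <= b] = set0.
Proof.
move=> b0; apply/seteqP; split => y //=.
by move=> /(le_trans (dot_ge0 _)); rewrite leNgt b0.
Qed.

Lemma enormD (u v : 'rV[R]_3) : enorm (u + v) <= enorm u + enorm v.
Proof.
rewrite -ler_sqr ?nnegrE ?addr_ge0 ?enorm_ge0// sqrrD !sqr_enorm.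
rewrite !dotDl !dotDr (dotC v u).
have : dot u v <= enorm u * enorm v.
  rewrite (le_trans (ler_norm _))// -ler_sqr ?nnegrE ?mulr_ge0 ?enorm_ge0//.
  by rewrite real_normK ?num_real// exprMn !sqr_enorm dot_cauchy_schwarz.
lra.
Qed.

Lemma eball_subset0 x r : eball x r `<=` eball 0 (r + enorm x).
Proof.
move=> y /= yr; rewrite /eball /= subr0 -[y](subrK x).
by rewrite (le_trans (enormD _ _))// lerD2r.
Qed.

(** Neighborhoods are given by open sup-norm balls; the closed Euclidean ball of half the radius
    fits inside. *)
Lemma open_sqdist (U : set 'rV[R]_3) x : open U -> U x ->
  exists2 a, 0 < a & [set y | dot (y - x) (y - x) <= a] `<=` U.
Proof.
move=> oU Ux; have /nbhs_ballP[e /= e0 eU] : nbhs x U by exact: open_nbhs_nbhs.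
exists ((e / 2) ^+ 2); first by rewrite exprn_gt0// divr_gt0.
move=> y /=; rewrite -sqr_enorm ler_sqr ?nnegrE ?enorm_ge0 ?divr_ge0 ?(ltW e0)//.
move=> ye; apply: eU; split => // i j; rewrite (ord1 i).
have := coord_le_enorm (y - x) j; rewrite !mxE distrC => yj.
rewrite -ball_normE/=; apply: (le_lt_trans yj).
by rewrite (le_lt_trans ye)// ltr_pdivrMr// ltr_pMr// ltr1n.
Qed.

Lemma measurable_sqdist_le x b :
  measurable [set y : 'rV[R]_3 | dot (y - x) (y - x) <= b].
Proof. exact: (measurable_sublevel_set (measurable_dot_sub x)). Qed.

End euclidean_balls.

(** * The inequality for varifolds *)

Section helfrich_inequality.
Context (R : realType).
Variables (V : {measure set ('rV[R]_3 * Go R) -> \bar R})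
  (beta : {measure set 'rV[R]_3 -> \bar R})
  (eta H : 'rV[R]_3 -> 'rV[R]_3) (c0 : R) (x0 : 'rV[R]_3).
Hypotheses (lbfvV : locally_bounded_first_variation V)
  (betaV : singular_part (first_variation_norm V) (weight_measure V) beta)
  (etaP : Linfty_sphere beta eta)
  (mH : measurable_fun setT H).
Hypothesis fvE : forall X, C1c X ->
  first_variation V X =
    - (\int[weight_measure V]_x dot (X x) (H x)) + \int[beta]_x dot (X x) (eta x).
Hypothesis Hperp : {ae V, forall z, wedge (H z.1) (star (Go_val z.2)) = 0}.
Hypothesis finH : (helfrich V c0 H < +oo)%E.
Hypothesis finD : (upper_density_oo (weight_measure V) < +oo)%E.
Hypothesis x0P : ~ spt beta x0.

Let s (z : 'rV[R]_3 * Go R) := dot (z.1 - x0) (z.1 - x0).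
Let N (z : 'rV[R]_3 * Go R) := dot (z.1 - x0) (star (Go_val z.2)).
Let h (z : 'rV[R]_3 * Go R) := dot (H z.1) (star (Go_val z.2)).
Let K z := H z.1 - c0 *: star (Go_val z.2).
Let t (x : 'rV[R]_3) := dot (x - x0) (x - x0).
Let Q (x : 'rV[R]_3) := dot (x - x0) (eta x).

Let mt : measurable_fun setT t. Proof. exact: measurable_dot_sub. Qed.
Let ms : measurable_fun setT s. Proof. exact: measurable_sqdist. Qed.
Let mN : measurable_fun setT N. Proof. exact: measurable_normal. Qed.
Let mh : measurable_fun setT h. Proof. exact: measurable_curvature. Qed.

Let mK2 : measurable_fun setT (fun z => dot (K z) (K z)).
Proof.
have mK : coord_measurable K.
  apply: coord_measurableB.
    exact: (coord_measurable_comp_fst (measurable_coord_measurable mH)).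
  exact: (coord_measurableZ (k := cst c0) _ (@coord_measurable_star R)).
exact: coord_measurable_dot.
Qed.

Let helfrichE : (helfrich V c0 H = (4^-1)%:E * \int[V]_z (dot (K z) (K z))%:E)%E.
Proof.
by congr (_ * _)%E; apply: eq_integral => z _; rewrite sqr_enorm.
Qed.

Let int_K2_ge0 : (0 <= \int[V]_z (dot (K z) (K z))%:E)%E.
Proof. by apply: integral_ge0 => z _; rewrite lee_fin dot_ge0. Qed.

Let K2_int : V.-integrable setT (EFin \o (fun z => dot (K z) (K z))).
Proof.
apply/integrableP; split; first exact/measurable_EFinP.
rewrite (eq_integral (fun z => (dot (K z) (K z))%:E)); last first.
  by move=> z _ /=; rewrite ger0_norm ?dot_ge0.
move: finH; rewrite helfrichE.
case: (\int[V]_z _)%E int_K2_ge0 => [r||]//; first by move=> *; rewrite ltry.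
by move=> _; rewrite gt0_muley ?lte_fin ?invr_gt0.
Qed.

Let helfrich_fin : helfrich V c0 H = (4^-1 * \int[V]_z dot (K z) (K z))%:E.
Proof.
rewrite helfrichE EFinM; congr (_ * _)%E.
by rewrite fineK//; exact: (integrable_fin_num measurableT K2_int).
Qed.

Let weightE r : 0 <= r ->
  weight_measure V (eball x0 r) = V [set z | (s z <= r ^+ 2)%R].
Proof. by move=> r0; rewrite eball_sqdist. Qed.

Let measurable_eball (x : 'rV[R]_3) r : measurable (eball x r).
Proof.
have [r0|r0] := leP 0 r; first by rewrite eball_sqdist//; exact: measurable_sqdist_le.
rewrite (_ : eball x r = set0); first exact: measurable0.
by apply/seteqP; split => y //= /(le_trans (enorm_ge0 _)); rewrite leNgt r0.
Qed.

Let fin_V b : (V [set z | (s z <= b)%R] < +oo)%E.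
Proof.
have [M [_ HM]] := limf_esup_pinfty_lt finD.
(* The ball of radius [r'] about 0 contains the given ball about [x0], and [r'] exceeds the
   threshold [M], so its density ratio is finite. The 1 keeps [pi * r' ^+ 2] positive. *)
pose r := Num.max (Num.sqrt `|b|) 1 + enorm x0.
pose r' := Num.max r (M + 1).
have r1 : 1 <= r'.
  by rewrite le_max /r ler_wpDr ?enorm_ge0// le_max lexx orbT.
have := HM r' _; rewrite lt_max ltrDl ltr01 orbT => /(_ isT).
have k0 : 0 < (pi * r' ^+ 2)^-1.
  by rewrite invr_gt0 mulr_gt0 ?pi_gt0// exprn_gt0// (lt_le_trans ltr01).
have fin : (weight_measure V (eball 0 r') < +oo)%E ->
    (V [set z | (s z <= b)%R] < +oo)%E.
  apply: le_lt_trans.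
  have Hsub : [set z | s z <= b] `<=` (fst @^-1` (eball 0 r')).
    move=> z /= zb.
    have : eball x0 (Num.max (Num.sqrt `|b|) 1) z.1.
      rewrite /eball /= le_max ler_wsqrtr//.
      by rewrite (le_trans zb)// ler_norm.
    by move/eball_subset0; rewrite /eball/= => /le_trans; apply; rewrite le_max lexx.
  apply: (le_measure V) => //; rewrite inE.
    exact: measurable_sublevel_set.
  by rewrite -[X in measurable X]setTI; apply: measurable_fst => //.
move=> fr; apply: fin; move: fr; rewrite /density_ratio.
case: (weight_measure V _) (measure_ge0 (weight_measure V) (eball 0 r')) => [w||]//.
  by move=> *; rewrite ltry.
by move=> _; rewrite gt0_mulye ?lte_fin.
Qed.

(** [beta] is a summand of the total variation of the first variation, which is finite on compact
    balls. *)
Let fin_beta b : (beta [set x | (t x <= b)%R] < +oo)%E.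
Proof.
have [b0|b0] := leP 0 b; last by rewrite sqdist_lt0// measure0 ltry.
have [nu [nuK _ _] nuE] := lbfvV; have [nua [nuaE _ _]] := betaV.
have mB := measurable_sqdist_le x0 b.
apply: le_lt_trans (nuK _ (@eball_compact _ x0 (Num.sqrt b))).
by rewrite -sqdist_sqrt// nuE// nuaE// leeDr// measure_ge0.
Qed.

Let null_beta : exists2 a, 0 < a & beta [set x | (t x <= a)%R] = 0%E.
Proof.
have [U [oU U0] Ux] : (\bigcup_(U in [set U | open U /\ beta U = 0%E]) U) x0.
  by apply: contrapT.
have [a a0 aU] := open_sqdist oU Ux; exists a => //.
apply/eqP; rewrite eq_le measure_ge0 andbT -U0; apply: le_measure => //.
  by rewrite inE; exact: measurable_sqdist_le.
by rewrite inE; exact: sub_sigma_algebra.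
Qed.

Let M b := \int[V]_z sublevel s b z.
Let E b := b^-1 * \int[V]_z (sublevel s b z * `|N z * (h z - c0)|).
Let W b := \int[V]_z (sublevel s b z * ((b^-1 - (s z)^-1) * N z)).
Let FB (b : R) x := sublevel t b x * (((t x)^-1 - b^-1) * Q x).
Let B b := \int[beta]_x FB b x.

Let s_ge0 z : 0 <= s z. Proof. exact: dot_ge0. Qed.
Let N_le_s z : N z ^+ 2 <= s z. Proof. exact: normal_le_sqdist. Qed.
Let g2_int : V.-integrable setT (EFin \o (fun z => (h z - c0) ^+ 2)).
Proof. exact: curvature_integrable. Qed.

Let M_ball r : 0 <= r -> (weight_measure V (eball x0 r) = (M (r ^+ 2))%:E)%E.
Proof.
move=> r0; rewrite weightE// -(integral_sublevel V ms).
have iM := integrable_sublevel ms fin_V (r ^+ 2).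
by rewrite fineK//; exact: (integrable_fin_num measurableT iM).
Qed.

Let mQ : measurable_fun setT Q.
Proof.
have [meta _] := etaP.
apply: coord_measurable_dot; last exact: measurable_coord_measurable meta.
exact: coord_measurableB (@coord_measurable_id _) (@coord_measurable_cst _ _ _ _).
Qed.

Let mFB b : measurable_fun setT (FB b).
Proof.
apply: measurable_funM; first exact: measurable_sublevel.
by apply: measurable_funM => //; apply: measurable_funB => //; exact: measurable_funV.
Qed.

Let mcutQ (a b : R) : measurable_fun setT (fun x => cutoff_limit a b (t x) * Q x).
Proof.
apply: measurable_funM => //; apply: measurable_fun_ifT => //.
  exact: measurable_fun_ler.
apply: measurable_fun_ifT => //; first exact: measurable_fun_ler.
by apply: measurable_funB => //; exact: measurable_funV.
Qed.

Section null_ball.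
Variable a0 : R.
Hypotheses (a0_gt0 : 0 < a0) (a0_null : beta [set x | (t x <= a0)%R] = 0%E).

Let t_gt_ae : {ae beta, forall x, a0 < t x}.
Proof.
exists [set x | t x <= a0]; split => //; first exact: measurable_sqdist_le.
by move=> x /= /negP; rewrite -leNgt.
Qed.

(** [beta]-almost everywhere [t > a0 >= a], so the inner branch is never seen and the boundary term
    is independent of [a]. *)
Let FB_ae (a b : R) : a <= a0 ->
  {ae beta, forall x, cutoff_limit a b (t x) * Q x = FB b x}.
Proof.
move=> aa; apply: filterS t_gt_ae => x tx.
rewrite /cutoff_limit /FB /sublevel leNgt (le_lt_trans aa tx)/=.
by case: ifP; rewrite ?mul1r ?mul0r.
Qed.

Let int_mono (a b : R) : 0 < a -> a <= a0 -> a < b ->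
  \int[V]_z mono_integrand s N h a b z = B b.
Proof.
move=> a1 aa ab.
rewrite (monotonicity_identity mH etaP.1 etaP.2 fvE Hperp K2_int fin_V fin_beta a1 ab).
exact: Rintegral_ae_eq (FB_ae b aa).
Qed.

Let B_eq0 b : b <= a0 -> B b = 0.
Proof.
move=> ba; rewrite /B (@Rintegral_ae_eq _ _ _ _ _ (cst 0))//.
  by rewrite Rintegral_cst// mul0r.
apply: filterS t_gt_ae => x tx.
by rewrite /FB /sublevel leNgt (le_lt_trans ba tx)/= mul0r.
Qed.

Lemma null_ball_integrable_weighted_normal b : V.-integrable setT
  (EFin \o (fun z => sublevel s b z * ((b^-1 - (s z)^-1) * N z))).
Proof.
exact: (integrable_weighted_normal ms mN mh s_ge0 N_le_s fin_V g2_int a0_gt0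
  int_mono B_eq0).
Qed.

Lemma null_ball_density_exists : exists L : R, a^-1 * M a @[a --> 0^'+] --> L.
Proof.
exact: (sublevel_ratio_cvg ms mN mh s_ge0 N_le_s fin_V g2_int a0_gt0 int_mono B_eq0).
Qed.

Lemma null_ball_density_le (L b : R) : 0 < b ->
  a^-1 * M a @[a --> 0^'+] --> L ->
  2 * L <= 2 * b^-1 * M b + (8^-1 * (\int[V]_z (h z - c0) ^+ 2) +
    (E b + (c0 * W b + B b))).
Proof.
exact: (sublevel_ratio_le ms mN mh s_ge0 N_le_s fin_V g2_int a0_gt0 int_mono B_eq0).
Qed.

(** [B b] is the [fine] part of an extended integral. Its finiteness is inherited from the truncated
    integrand, which agrees with [FB b] almost everywhere. *)
Lemma null_ball_boundary_integral b : 0 < b ->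
  (\int[beta]_x (FB b x)%:E = (B b)%:E)%E.
Proof.
move=> b0; rewrite fineK//.
pose a := Num.min a0 (b / 2).
have a1 : 0 < a by rewrite lt_min a0_gt0 divr_gt0.
have aa : a <= a0 by rewrite ge_min lexx.
have ab : a < b by rewrite gt_min ltr_pdivrMr// ltr_pMr// ltr1n orbT.
have bi := boundary_integrable etaP.1 etaP.2 fin_beta a1 ab.
have -> : (\int[beta]_x (FB b x)%:E =
    \int[beta]_x (cutoff_limit a b (t x) * Q x)%:E)%E.
  apply: ae_eq_integral => //; try exact/measurable_EFinP.
  by apply: filterS (FB_ae b aa) => x /= -> _.
exact: (integrable_fin_num measurableT bi).
Qed.

End null_ball.

Let g2_le : \int[V]_z (h z - c0) ^+ 2 <= \int[V]_z dot (K z) (K z).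
Proof.
apply: le_Rintegral => // z _.
have n1 := Go_set_dot_star (Go_valP z.2).
rewrite (_ : h z - c0 = dot (K z) (star (Go_val z.2))).
  by apply: le_trans (dot_cauchy_schwarz _ _) _; rewrite n1 mulr1.
by rewrite /K dotBl dotZl n1 mulr1.
Qed.

Let pi0 : 0 < pi :> R. Proof. exact: pi_gt0. Qed.

(** The growth hypothesis is centered at 0. The inclusion of the ball about [x0] in a ball of radius
    [r + |x0|] costs a factor that tends to 1. *)
Let ratio_le u : (upper_density_oo (weight_measure V) < u%:E)%E ->
  \forall r \near +oo, (r ^+ 2)^-1 * M (r ^+ 2) <= u * pi * (1 + enorm x0 / r) ^+ 2.
Proof.
move=> /limf_esup_pinfty_lt[A [_ HA]].
near=> r.
have r0 : 0 < r by near: r; exact: nbhs_pinfty_gt.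
have rA : A < r by near: r; apply: nbhs_pinfty_gt; rewrite num_real.
have q0 : 0 < r + enorm x0 by rewrite ltr_pwDl ?enorm_ge0.
have := HA (r + enorm x0) _.
rewrite (lt_le_trans rA) ?lerDl ?enorm_ge0// => /(_ isT).
rewrite /density_ratio => H1.
have H2 : (weight_measure V (eball x0 r) <=
    weight_measure V (eball 0 (r + enorm x0)))%E.
  apply: le_measure; rewrite ?inE; [exact: measurable_eball..|].
  exact: eball_subset0.
have k0 : 0 < (pi * (r + enorm x0) ^+ 2)^-1 by rewrite invr_gt0 mulr_gt0// exprn_gt0.
have : (weight_measure V (eball x0 r) * ((pi * (r + enorm x0) ^+ 2)^-1)%:E < u%:E)%E.
  by apply: le_lt_trans H1; rewrite lee_pmul2r// lte_fin.
rewrite M_ball ?(ltW r0)// -EFinM lte_fin ltr_pdivrMr ?mulr_gt0 ?exprn_gt0// => H3.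
rewrite ler_pdivrMl ?exprn_gt0// (le_trans (ltW H3))//.
rewrite le_eqVlt; apply/orP; left; apply/eqP; field; rewrite gt_eqF//.
Unshelve. all: by end_near. Qed.

Let error_cvg e : 0 < e -> \forall r \near +oo, E (r ^+ 2) <= e.
Proof.
move=> e0.
have [u Uu] : exists u : R, (upper_density_oo (weight_measure V) < u%:E)%E.
  case: (upper_density_oo _) finD => [v||]// _; last by exists 0; exact: ltNyr.
  by exists (v + 1); rewrite lte_fin ltrDl.
have [A [_ HA]] := ratio_le Uu.
(* [b] is a squared radius, hence the squared threshold; for radii at least 1 the recentering factor
   is at most [(1 + |x0|)^2]. *)
have MC b : (Num.max (A + 1) 1) ^+ 2 <= b ->
    b^-1 * M b <= `|u| * pi * (1 + enorm x0) ^+ 2.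
  move=> Ab; pose r := Num.sqrt b.
  have m1 : 1 <= Num.max (A + 1) 1 by rewrite le_max lexx orbT.
  have b0 : 0 <= b by rewrite (le_trans _ Ab)// sqr_ge0.
  have rm : Num.max (A + 1) 1 <= r.
    by rewrite -ler_sqr ?nnegrE ?sqrtr_ge0 ?(le_trans _ m1)// sqr_sqrtr.
  have r1 : 1 <= r by rewrite (le_trans m1).
  have -> : b = r ^+ 2 by rewrite sqr_sqrtr.
  have Ar : A < r by rewrite (lt_le_trans _ rm)// lt_max ltrDl ltr01.
  rewrite (le_trans (HA _ Ar))//.
  have nr : 0 <= enorm x0 / r by rewrite divr_ge0 ?enorm_ge0// (le_trans _ r1).
  have q : (1 + enorm x0 / r) ^+ 2 <= (1 + enorm x0) ^+ 2.
    rewrite ler_sqr ?nnegrE ?addr_ge0 ?enorm_ge0// lerD2l.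
    by rewrite ler_pdivrMr ?(lt_le_trans ltr01 r1)// ler_peMr ?enorm_ge0.
  apply: (@le_trans _ _ (`|u| * pi * (1 + enorm x0 / r) ^+ 2)).
    by rewrite ler_wpM2r ?sqr_ge0// ler_wpM2r ?(ltW pi0)// ler_norm.
  by rewrite ler_wpM2l// mulr_ge0// ltW.
have cE := sublevel_error_cvg ms mN mh s_ge0 N_le_s fin_V g2_int MC.
have /cvgrPdist_le /(_ _ e0)[A' [_ HA']] := cE.
near=> r.
have r1 : 1 <= r by near: r; apply: nbhs_pinfty_ge; rewrite num_real.
have rA : A' < r by near: r; apply: nbhs_pinfty_gt; rewrite num_real.
have := HA' (r ^+ 2) _; rewrite sub0r normrN.
rewrite (lt_le_trans rA) ?ler_eXnr// => /(_ isT); apply: le_trans.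
exact: ler_norm.
Unshelve. all: by end_near. Qed.

Let LV_integral r : 0 < r ->
  (\int[V]_(z in eball x0 r `*` setT)
    ((r ^- 2 - enorm (z.1 - x0) ^- 2) * N z)%:E = (W (r ^+ 2))%:E)%E.
Proof.
move=> r0; have [a a0 a_null] := null_beta.
have iW := null_ball_integrable_weighted_normal a0 a_null (r ^+ 2).
rewrite /W /Rintegral fineK; last exact: (integrable_fin_num measurableT iW).
rewrite [LHS]integral_mkcond; apply: eq_integral => z _.
rewrite patchE /sublevel.
have -> : (z \in eball x0 r `*` setT) = (s z <= r ^+ 2).
  apply/idP/idP; rewrite inE => zr.
    by move: zr => -[+ _]; rewrite eball_sqdist ?(ltW r0).
  by split => //; rewrite eball_sqdist ?(ltW r0).
by case: ifP => _; rewrite ?mul0r// mul1r -exprVn sqr_enorm.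
Qed.

Let Lbeta_integral r : 0 < r ->
  (\int[beta]_(x in eball x0 r)
    ((enorm (x - x0) ^- 2 - r ^- 2) * Q x)%:E = (B (r ^+ 2))%:E)%E.
Proof.
move=> r0; have [a a0 a_null] := null_beta.
rewrite -(null_ball_boundary_integral a0 a_null) ?exprn_gt0//.
rewrite [LHS]integral_mkcond; apply: eq_integral => x _.
rewrite patchE /FB /sublevel.
have -> : (x \in eball x0 r) = (t x <= r ^+ 2).
  by rewrite eball_sqdist ?(ltW r0)//; apply/idP/idP; rewrite inE.
by case: ifP => _; rewrite ?mul0r// mul1r sqr_enorm.
Qed.

Let upper_density_ge0 : (0 <= upper_density_oo (weight_measure V))%E.
Proof.
apply: le_ereal_inf_tmp => /= _ [A [m [_ HA]] <-].
apply: le_ereal_sup_tmp; exists (density_ratio (weight_measure V) 0 (m + 1)).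
  by exists (m + 1) => //; apply: HA; rewrite ltrDl.
by rewrite mule_ge0 ?measure_ge0// lee_fin invr_ge0 mulr_ge0 ?sqr_ge0// ltW.
Qed.

Lemma helfrich_density_bound :
  exists2 theta : R, is_density (weight_measure V) x0 theta &
    let LV := limf_esup (fun rho : R => (c0 / (2 * pi))%:E *
        \int[V]_(z in eball x0 rho `*` setT)
          ((rho ^- 2 - enorm (z.1 - x0) ^- 2) *
           dot (z.1 - x0) (star (Go_val z.2)))%:E)%E +oo in
    let Lbeta := limf_esup (fun rho : R => (1 / (2 * pi))%:E *
        \int[beta]_(x in eball x0 rho)
          ((enorm (x - x0) ^- 2 - rho ^- 2) * dot (x - x0) (eta x))%:E)%E +oo in
    (LV +? Lbeta ->
      theta%:E <= upper_density_oo (weight_measure V)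
                  + (1 / (4 * pi))%:E * helfrich V c0 H + LV + Lbeta)%E.
Proof.
have [a0 a0_gt0 a0_null] := null_beta.
have [L cL] := null_ball_density_exists a0_gt0 a0_null.
exists (L / pi).
  have sq0 : (fun r : R => r ^+ 2) @ 0^'+ --> 0^'+.
    move=> A /nbhs_ballP[e /= e0 eA].
    rewrite -[_ A]/(\forall r \near 0^'+, A (r ^+ 2)); near=> r.
    have r0 : 0 < r by near: r; exact: nbhs_right_gt.
    have r1 : r < 1 by near: r; exact: nbhs_right_lt.
    have re : r < e by near: r; exact: nbhs_right_lt.
    have r20 : 0 < r ^+ 2 by rewrite exprn_gt0.
    apply: eA => //; rewrite -ball_normE /ball_/= sub0r normrN gtr0_norm//.
    by rewrite (le_lt_trans _ re)// expr2 ler_piMr// ltW.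
  have cM : (r ^+ 2)^-1 * M (r ^+ 2) @[r --> 0^'+] --> L.
    exact: (@cvg_comp _ _ _ (fun r => r ^+ 2) (fun a => a^-1 * M a) _ _ _ sq0 cL).
  have cM' : ((r ^+ 2)^-1 * M (r ^+ 2) / pi)%:E @[r --> 0^'+] --> (L / pi)%:E.
    apply: cvg_EFin; first by apply: nearW.
    by apply: cvgM => //; exact: cvg_cst.
  apply: cvg_trans cM'; apply: near_eq_cvg; near=> r.
  have r0 : 0 < r by near: r; exact: nbhs_right_gt.
  rewrite /density_ratio M_ball ?(ltW r0)// -EFinM; congr EFin.
  by move: (pi : R) pi0 => p p0; field; rewrite !gt_eqF.
move=> LV Lbeta def.
have kE : (upper_density_oo (weight_measure V) +
    (1 / (4 * pi))%:E * helfrich V c0 H =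
  (fine (upper_density_oo (weight_measure V)) +
    (16 * pi)^-1 * \int[V]_z dot (K z) (K z))%:E)%E.
  rewrite EFinD fineK ?ge0_fin_numE// helfrich_fin -EFinM; congr (_ + _%:E)%E.
  by move: (pi : R) pi0 => p p0; field; rewrite gt_eqF.
rewrite kE; set k := fine _ + _.
(* If one upper limit is [+oo], then [LV +? Lbeta] keeps the other from being [-oo], and the
   right-hand side is [+oo]. *)
have [LVy|LVy] := eqVneq LV +oo%E.
  move: def; rewrite LVy; case: Lbeta => [b||]//= _; by rewrite leey.
have [LBy|LBy] := eqVneq Lbeta +oo%E.
  by move: def; rewrite LBy; case: LV LVy => [b||]//= _ _; rewrite leey.
apply: lee_add_of_lt => // a b e LVa LBb e0.
(* The slack [e] is shared equally by the upper density, the recentering factor and the error; the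
   last is allowed [pi * (2 * e / 3)] because it gets divided by [2 pi]. *)
pose u := fine (upper_density_oo (weight_measure V)) + e / 3.
have e3 : 0 < e / 3 by rewrite divr_gt0.
have Uu : (upper_density_oo (weight_measure V) < u%:E)%E.
  by rewrite -[ltLHS]fineK ?ge0_fin_numE// lte_fin ltrDl.
have u0 : 0 <= u by rewrite addr_ge0 ?(ltW e3)// fine_ge0.
have cu : u * (1 + enorm x0 / r) ^+ 2 @[r --> +oo] --> u * (1 + 0) ^+ 2.
  have c1 : 1 + enorm x0 / r @[r --> +oo] --> (1 + 0 : R).
    apply: cvgD; first exact: cvg_cst.
    rewrite -[X in _ --> X](mulr0 (enorm x0)); apply: cvgM; first exact: cvg_cst.
    by apply/gtr0_cvgV0; [exact: nbhs_pinfty_gt|exact: cvg_id].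
  by apply: cvgM; [exact: cvg_cst|apply: cvgM].
have /cvgrPdist_le /(_ _ e3) cu' := cu.
have pe : 0 < pi * (2 * e / 3) by rewrite mulr_gt0// divr_gt0// mulr_gt0.
near (+oo%R : set_system R) => r.
have r0 : 0 < r by near: r; exact: nbhs_pinfty_gt.
have r20 : 0 < r ^+ 2 by rewrite exprn_gt0.
have Ha : ((c0 / (2 * pi))%:E * \int[V]_(z in eball x0 r `*` setT)
    ((r ^- 2 - enorm (z.1 - x0) ^- 2) * N z)%:E < a%:E)%E.
  by near: r; exact: limf_esup_pinfty_lt LVa.
have Hb : ((1 / (2 * pi))%:E * \int[beta]_(x in eball x0 r)
    ((enorm (x - x0) ^- 2 - r ^- 2) * Q x)%:E < b%:E)%E.
  by near: r; exact: limf_esup_pinfty_lt LBb.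
rewrite LV_integral// -EFinM lte_fin in Ha.
rewrite Lbeta_integral// -EFinM lte_fin in Hb.
have Hm : (r ^+ 2)^-1 * M (r ^+ 2) <= u * pi * (1 + enorm x0 / r) ^+ 2.
  by near: r; exact: ratio_le Uu.
have Hu : `|u * (1 + 0) ^+ 2 - u * (1 + enorm x0 / r) ^+ 2| <= e / 3.
  by near: r; exact: cu'.
have He : E (r ^+ 2) <= pi * (2 * e / 3) by near: r; exact: error_cvg pe.
have HL := null_ball_density_le a0_gt0 a0_null r20 cL.
have Hcw : c0 * W (r ^+ 2) < a * (2 * pi) by rewrite -ltr_pdivrMr ?mulr_gt0// mulrAC.
have Hbb : B (r ^+ 2) < b * (2 * pi).
  by rewrite -ltr_pdivrMr ?mulr_gt0// mulrC -[_^-1]mul1r.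
rewrite ler_pdivrMr// /k.
have Hmu : u * pi * (1 + enorm x0 / r) ^+ 2 <= pi * (u + e / 3).
  rewrite mulrAC mulrC ler_pM2l//; move: Hu; rewrite addr0 expr1n mulr1 ler_norml.
  by move=> /andP[]; lra.
have Hk : (16 * pi)^-1 * (\int[V]_z dot (K z) (K z)) * pi =
    16^-1 * \int[V]_z dot (K z) (K z).
  by move: (pi : R) pi0 => p p0; field; rewrite gt_eqF.
rewrite -[2 * _ * M _]mulrA in HL.
move: (le_trans Hm Hmu) Hk HL g2_le He Hcw Hbb; rewrite /u.
move: (_^-1 * M _) (fine _) => m U.
move: ((16 * pi)^-1 * \int[V]_z dot (K z) (K z)) => y.
lra.
Unshelve. all: by end_near. Qed.

End helfrich_inequality.

Theorem theorem4p2 (R : realType)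
    (V : {measure set ('rV[R]_3 * Go R) -> \bar R})
    (beta : {measure set 'rV[R]_3 -> \bar R})
    (eta H : 'rV[R]_3 -> 'rV[R]_3) (c0 : R)
    (radonV : radon V)
    (lbfvV : locally_bounded_first_variation V)
    (betaV : singular_part (first_variation_norm V) (weight_measure V) beta)
    (etaP : Linfty_sphere beta eta)
    (HP : L1loc (weight_measure V) H)
    (fvE : forall X, C1c X ->
      first_variation V X =
        - (\int[weight_measure V]_x dot (X x) (H x)) + \int[beta]_x dot (X x) (eta x))
    (Hperp : {ae V, forall z, wedge (H z.1) (star (Go_val z.2)) = 0})
    (finH : (helfrich V c0 H < +oo)%E)
    (finD : (upper_density_oo (weight_measure V) < +oo)%E)
    (x0 : 'rV[R]_3) (x0P : ~ spt beta x0) :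
  exists2 theta : R, is_density (weight_measure V) x0 theta &
    let LV := limf_esup (fun rho : R => (c0 / (2 * pi))%:E *
        \int[V]_(z in eball x0 rho `*` setT)
          ((rho ^- 2 - enorm (z.1 - x0) ^- 2) *
           dot (z.1 - x0) (star (Go_val z.2)))%:E)%E +oo in
    let Lbeta := limf_esup (fun rho : R => (1 / (2 * pi))%:E *
        \int[beta]_(x in eball x0 rho)
          ((enorm (x - x0) ^- 2 - rho ^- 2) * dot (x - x0) (eta x))%:E)%E +oo in
    (LV +? Lbeta ->
      theta%:E <= upper_density_oo (weight_measure V)
                  + (1 / (4 * pi))%:E * helfrich V c0 H + LV + Lbeta)%E.
Proof.
have [mH _] := HP.
exact: (helfrich_density_bound lbfvV betaV etaP mH fvE Hperp finH finD x0P).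
Qed.
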